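(* Let $1<p<2$ and set $\mu:=\frac{2p}{p+2}\in(0,1)$. Assume: (i) there exist $\rho_0>0$ and $C_{\boldsymbol{\sigma}}>0$ with $|\boldsymbol{\sigma}(x)|\le C_{\boldsymbol{\sigma}}|x-x_0|^{-1}$ for a.e. $x\in B_{\rho_0}(x_0)\setminus\{x_0\}$; (ii) $\boldsymbol{\sigma}|_K\in W^{1,p}(K)^2$ for every element $K$ not contained in the patch $\omega_{x_0}$, and $\omega_{x_0}\subset B_{\rho_0}(x_0)$ (which holds once $h_{x_0}$ is small enough); (iii) $|\nabla_{\mathcal P}\boldsymbol{\sigma}(x)|\le C_{\boldsymbol{\sigma}}|x-x_0|^{-2}$ for a.e. $x\in B_{\rho_0}(x_0)\setminus\{x_0\}$, and $\nabla_{\mathcal P}\boldsymbol{\sigma}\in L^p(\Omega\setminus\overline{B_{\rho_0}(x_0)})$; (iv) there is $C_{\mathrm{SP}}>0$, independent of the mesh, such that $\|R_h\boldsymbol{\rho}\|_{L^p(\Omega)}\le C_{\mathrm{SP}}\|\boldsymbol{\rho}\|_{L^p(\Omega)}$ for all $\boldsymbol{\rho}\in L^p(\Omega)^2$. Let $\{\mathcal T_c\}_{c>0}$ be shape-regular families of triangulations of $\Omega$, fitted to $\mathcal P$, graded so that $$h_K\simeq c\,\bigl(\max\{|x_K-x_0|,h_{x_0}\}\bigr)^{\mu}\ \text{ for }K\subset B_{\rho_0}(x_0),\qquad h_K\simeq c\ \text{ otherwise},$$ with $x_K$ the barycenter of $K$ and $h_{x_0}\simeq c^{(p+2)/(2-p)}$.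 Consider the flux estimate $$\|\boldsymbol{\sigma}-\boldsymbol{\sigma}_h\|_{L^p(\Omega)}\le C(1+C_{\mathrm{SP}})\Bigl(C_{\boldsymbol{\sigma}}h_{x_0}^{2/p-1}+h_{x_0}\|f_1\|_{L^p(\omega_{x_0})}+\Bigl(\sum_{K\not\subset\omega_{x_0}}h_K^{p}\,|\boldsymbol{\sigma}|_{W^{1,p}(K)}^{p}\Bigr)^{1/p}\Bigr),$$ which holds under these hypotheses. Then the patch approximation term $C_{\boldsymbol{\sigma}}h_{x_0}^{2/p-1}$ of this estimate and the bounds on its elementwise terms $h_K|\boldsymbol{\sigma}|_{W^{1,p}(K)}$, $K\not\subset\omega_{x_0}$, all sit at the common scale $Cc^{1+2/p}$; the source term $h_{x_0}\|f_1\|_{L^p(\omega_{x_0})}$ on the patch is of higher order; the number $N$ of elements satisfies $N\simeq c^{-2}$; and $$\|\boldsymbol{\sigma}-\boldsymbol{\sigma}_h\|_{L^p(\Omega)}\le CN^{-1/2}.$$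
   Context: Continuous problem. $\Omega\subset\mathbb R^2$ is a bounded, simply connected Lipschitz domain, $x_0\in\Omega$, $1<p<2$. The matrix field $A\in L^\infty(\Omega;\mathbb R^{2\times 2})$ is symmetric and uniformly elliptic: $\alpha|\xi|^2\le\xi^TA(x)\xi\le\beta|\xi|^2$ for all $\xi\in\mathbb R^2$ and a.e. $x\in\Omega$, with $0<\alpha\le\beta$. Data: $f_1\in L^p(\Omega)$, $g\in W^{1-1/p,p}(\partial\Omega)$. It is assumed that $-\nabla\cdot(A\nabla u)=f_1+\delta_{x_0}$ in $\Omega$, $u=g$ on $\partial\Omega$, has a unique solution $u\in W^{1,p}(\Omega)$. Let $\mathbf f_2(x):=\frac1{2\pi}\frac{x-x_0}{|x-x_0|^2}$ (so $\nabla\cdot\mathbf f_2=\delta_{x_0}$ in the sense of distributions) and let $\boldsymbol{\sigma}:=-A\nabla u-\mathbf f_2\in L^p(\Omega)^2$ be the modified flux; it satisfies $\nabla\cdot\boldsymbol{\sigma}=f_1$. Discrete problem on a triangulation $\mathcal T_h$ (here $\mathcal T_h=\mathcal T_c$). $h_K=\operatorname{diam}K$. $\mathrm{RT}_0(\mathcal T_h)$ is the space of $\boldsymbol{\tau}_h\in H(\mathrm{div};\Omega)$ with $\boldsymbol{\tau}_h|_K(x)=\mathbf a+bx$, $\mathbf a\in\mathbb R^2$, $b\in\mathbb R$, on each $K\in\mathcal T_h$; $P_0(\mathcal T_h)$ is the space of piecewise constant functions. $(\cdot,\cdot)$ denotes the integral over $\Omega$ of the product. The pair $(\boldsymbol{\sigma}_h,u_h)\in\mathrm{RT}_0(\mathcal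 T_h)\times P_0(\mathcal T_h)$ is the unique solution of $$(A^{-1}\boldsymbol{\sigma}_h,\boldsymbol{\tau}_h)-(\nabla\cdot\boldsymbol{\tau}_h,u_h)=-(A^{-1}\mathbf f_2,\boldsymbol{\tau}_h)-\langle\boldsymbol{\tau}_h\cdot\mathbf n,g\rangle_{\partial\Omega}\quad\forall\boldsymbol{\tau}_h\in\mathrm{RT}_0(\mathcal T_h),$$ $$(\nabla\cdot\boldsymbol{\sigma}_h,v_h)=(f_1,v_h)\quad\forall v_h\in P_0(\mathcal T_h).$$ $K_h:=\{\boldsymbol{\tau}_h\in\mathrm{RT}_0(\mathcal T_h):\nabla\cdot\boldsymbol{\tau}_h=0\}$; for $\boldsymbol{\rho}\in L^p(\Omega)^2$, $R_h\boldsymbol{\rho}\in K_h$ is defined by $(A^{-1}R_h\boldsymbol{\rho},\boldsymbol{\tau}_h)=(A^{-1}\boldsymbol{\rho},\boldsymbol{\tau}_h)$ for all $\boldsymbol{\tau}_h\in K_h$. Partition and patch. $\mathcal P=\{\Omega_j\}_{j=1}^J$ is a finite partition of $\Omega$ into pairwise disjoint Lipschitz subdomains, $\overline\Omega=\bigcup_j\overline{\Omega_j}$, subordinate to the interfaces of the coefficient $A$; $\nabla_{\mathcal P}\mathbf v:=\nabla(\mathbf v|_{\Omega_j})$ in $\Omega_j$. $\mathcal T_h$ is fitted to $\mathcal P$ if every $K\in\mathcal T_h$ is contained in the closure of a single $\Omega_j$. The patch $\omega_{x_0}$ is an edge-connected union of elements (any two joined by a chain of elements sharing full edges), containing every element whose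 closure contains $x_0$, with a uniformly bounded number of elements, and with $\operatorname{diam}(\omega_{x_0})\simeq h_{x_0}$ and $\operatorname{dist}(x_0,\partial\omega_{x_0})\simeq h_{x_0}$, where $h_{x_0}:=\max\{h_K:K\subset\omega_{x_0}\}$, all with constants uniform in the family. $B_{\rho_0}(x_0)$ is the open ball of radius $\rho_0$ about $x_0$, and $|\cdot|_{W^{1,p}(K)}$ is the $L^p(K)$ norm of the gradient. $C$ denotes a constant independent of $c$, and $a\simeq b$ means two-sided bounds with constants independent of the mesh parameter.
   Formalization: For elements outside the patch not contained in the ball B_{ρ0}(x0), the bound proved is C(c^{1+2/p} + c‖∇_Pσ‖_{L^p(K∖B̄)}), plus the scale c^{1+2/p} for the p-mean of all elementwise terms; the literal bound fails if ∇_Pσ is unbounded there. *)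

(* Defs.v *)
From HB Require Import structures.
From mathcomp Require Import all_boot all_order all_algebra.
From mathcomp Require Import all_classical all_reals all_analysis.
Import Order.TTheory GRing.Theory Num.Theory.
Import numFieldNormedType.Exports.
Set Implicit Arguments.
Unset Strict Implicit.
Unset Printing Implicit Defensive.

Local Open Scope classical_set_scope.
Local Open Scope ring_scope.

Section Plane.
Variable R : realType.
Local Notation R2 := (R * R)%type.
(* The same type with the product of the Borel sigma-algebras that carry
   [lebesgue_measure]. *)
Local Notation M2 := (measurableTypeR R * measurableTypeR R)%type.

(* The library norm on [R * R] is the sup norm, hence the explicit Euclidean
   norm; both induce the product topology used for [open], [closure] etc. *)
Definition dot (v w : R2) : R := v.1 * w.1 + v.2 * w.2.
Definition enorm (v : R2) : R := Num.sqrt (dot v v).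
Definition frobnorm (M : R2 * R2) : R := enorm (enorm M.1, enorm M.2).
Definition mxv (M : 'M[R]_2) (v : R2) : R2 :=
  (M 0 0 * v.1 + M 0 1 * v.2, M 1 0 * v.1 + M 1 1 * v.2).

Definition eball (x : R2) (r : R) : set R2 := [set y | enorm (y - x) < r].
Definition bdry (U : set R2) : set R2 := closure U `\` U°.

(* For bounded sets only: [sup] and [inf] of the library are 0 on sets of reals
   that are empty or unbounded. *)
Definition diam (E : set R2) : R :=
  sup [set r | exists x y, [/\ E x, E y & r = enorm (x - y)]].
Definition distpt (x : R2) (E : set R2) : R := inf [set enorm (x - y) | y in E].

Definition simeq (k a b : R) : Prop := a <= k * b /\ b <= k * a.

Definition leb2 : {measure set M2 -> \bar R} :=
  (@lebesgue_measure R \x @lebesgue_measure R)%E.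

Definition domain (U : set R2) : Prop := [/\ open U, connected U & U !=set0].

(* Near each boundary point, in suitable orthonormal coordinates, [U] is the
   strict epigraph of a Lipschitz function. *)
Definition lipschitz_boundary (U : set R2) : Prop :=
  forall z, bdry U z -> exists (e : R2) (r L : R) (psi : R -> R),
    [/\ enorm e = 1, 0 < r, (forall s t, `|psi s - psi t| <= L * `|s - t|) &
      forall x, eball z r x ->
        (U x <-> psi (dot (- e.2, e.1) (x - z)) < dot e (x - z))].

Definition lipschitz_domain (U : set R2) : Prop :=
  domain U /\ lipschitz_boundary U.

(* Free homotopies suffice, since it is only used for path-connected sets. *)
Definition simply_connected (U : set R2) : Prop :=
  forall gam : R -> R2,
    {within `[0, 1], continuous gam} -> gam @` `[0, 1] `<=` U -> gam 0 = gam 1 ->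
  exists (H : R2 -> R2) (z : R2),
    [/\ {within `[0, 1] `*` `[0, 1], continuous H},
        H @` (`[0, 1] `*` `[0, 1]) `<=` U,
        (forall s, s \in `[0, 1] -> H (s, 0) = gam s),
        (forall s, s \in `[0, 1] -> H (s, 1) = z) &
        forall t, t \in `[0, 1] -> H (0, t) = H (1, t)].

Section Lebesgue.
Variable mu : {measure set M2 -> \bar R}.
Local Open Scope ereal_scope.

Definition LpN (p : \bar R) (U : set R2) (f : R2 -> R) : \bar R :=
  Lnorm mu p (EFin \o (f \_ U) : M2 -> \bar R).
Definition Lp (p : \bar R) (U : set R2) (f : R2 -> R) : Prop :=
  measurable_fun (U : set M2) (f : M2 -> R) /\ LpN p U f < +oo.
Definition LpV (p : \bar R) (U : set R2) (F : R2 -> R2) : Prop :=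
  Lp p U (fst \o F) /\ Lp p U (snd \o F).

End Lebesgue.

Definition pd1 (f : R2 -> R) (x : R2) : R := 'D_((1, 0) : R2) f x.
Definition pd2 (f : R2 -> R) (x : R2) : R := 'D_((0, 1) : R2) f x.
Definition grad (f : R2 -> R) (x : R2) : R2 := (pd1 f x, pd2 f x).

Fixpoint Ck (k : nat) (f : R2 -> R) : Prop :=
  continuous f /\
  if k is k'.+1 then
    [/\ (forall x, derivable f x ((1, 0) : R2)),
        (forall x, derivable f x ((0, 1) : R2)), Ck k' (pd1 f) & Ck k' (pd2 f)]
  else True.
Definition smooth (f : R2 -> R) : Prop := forall k, Ck k f.

Definition test_function (U : set R2) (phi : R2 -> R) : Prop :=
  smooth phi /\
  exists Q, [/\ compact Q, Q `<=` U & forall x, ~ Q x -> phi x = 0].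

Definition loc_integrable (U : set R2) (v : R2 -> R) : Prop :=
  measurable_fun (U : set M2) (v : M2 -> R) /\
  forall Q, compact Q -> Q `<=` U -> leb2.-integrable Q (EFin \o v).

Definition weak_grad (U : set R2) (v : R2 -> R) (G : R2 -> R2) : Prop :=
  [/\ loc_integrable U v, loc_integrable U (fst \o G),
      loc_integrable U (snd \o G) &
      forall phi, test_function U phi ->
        (\int[leb2]_(x in U) (v x * pd1 phi x) =
           - \int[leb2]_(x in U) ((G x).1 * phi x)) /\
        (\int[leb2]_(x in U) (v x * pd2 phi x) =
           - \int[leb2]_(x in U) ((G x).2 * phi x))].

Definition weak_div (U : set R2) (tau : R2 -> R2) (d : R2 -> R) : Prop :=
  [/\ loc_integrable U (fst \o tau), loc_integrable U (snd \o tau),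
      loc_integrable U d &
      forall phi, test_function U phi ->
        \int[leb2]_(x in U) dot (tau x) (grad phi x) =
          - \int[leb2]_(x in U) (d x * phi x)].

Definition W1p_grad (p : R) (U : set R2) (v : R2 -> R) (G : R2 -> R2) : Prop :=
  [/\ Lp leb2 p%:E U v, weak_grad U v G & LpV leb2 p%:E U G].
Definition W1p (p : R) (U : set R2) (v : R2 -> R) : Prop :=
  exists G, W1p_grad p U v G.
Definition W1pV (p : R) (U : set R2) (F : R2 -> R2) : Prop :=
  W1p p U (fst \o F) /\ W1p p U (snd \o F).

Definition weak_gradV (U : set R2) (F : R2 -> R2) (G : R2 -> R2 * R2) : Prop :=
  weak_grad U (fst \o F) (fst \o G) /\ weak_grad U (snd \o F) (snd \o G).

(* Weak gradients are unique almost everywhere, so the infimum is the L^p norm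
   of the gradient of [F] on [U]; it is +oo when there is no weak gradient. *)
Definition W1p_seminorm (p : R) (U : set R2) (F : R2 -> R2) : \bar R :=
  ereal_inf [set LpN leb2 p%:E U (frobnorm \o G) | G in weak_gradV U F].

(* One-dimensional Hausdorff (outer) measure, normalized to be length. *)
Definition hausdorff1 (B : set R2) : \bar R :=
  ereal_sup [set m | exists2 delta : R, 0 < delta &
    m = ereal_inf [set (\sum_(k <oo) (diam (E k))%:E)%E |
          E in [set E : nat -> set R2 | B `<=` \bigcup_k E k /\
                  forall k x y, E k x -> E k y -> enorm (x - y) <= delta]]].

Definition surface_measure (U : set R2) (s : {measure set M2 -> \bar R}) : Prop :=
  forall B : set M2, measurable B -> s B = hausdorff1 (B `&` bdry U).

(* The Sobolev-Slobodeckij space W^{theta,p} on the (one-dimensional) boundary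
   of [U], with surface measure [s]. *)
Definition Wfrac (theta p : R) (U : set R2) (s : {measure set M2 -> \bar R})
    (g : R2 -> R) : Prop :=
  Lp s p%:E (bdry U) g /\
  (\int[s]_(x in bdry U) \int[s]_(y in bdry U)
     ((`|g x - g y| `^ p / enorm (x - y) `^ (1 + theta * p))%R)%:E < +oo)%E.

(* [g] is the trace on the boundary of [U] of [u], with weak gradient [Du]. *)
Definition is_trace (p : R) (U : set R2) (s : {measure set M2 -> \bar R})
    (u : R2 -> R) (Du : R2 -> R2) (g : R2 -> R) : Prop :=
  exists phi : nat -> R2 -> R,
    [/\ forall n, smooth (phi n),
        LpN leb2 p%:E U (fun x => phi n x - u x) @[n --> \oo] --> 0%E,
        LpN leb2 p%:E U (fun x => enorm (grad (phi n) x - Du x))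
          @[n --> \oo] --> 0%E &
        LpN s p%:E (bdry U) (fun x => phi n x - g x) @[n --> \oo] --> 0%E].

Definition elliptic_field (alpha beta : R) (U : set R2) (A : R2 -> 'M[R]_2) : Prop :=
  [/\ 0 < alpha, alpha <= beta,
      (forall i j, Lp leb2 +oo%E U (fun x => A x i j)) &
      {ae leb2, forall x, U x -> (A x)^T = A x /\
        forall xi, alpha * enorm xi ^+ 2 <= dot xi (mxv (A x) xi) /\
                   dot xi (mxv (A x) xi) <= beta * enorm xi ^+ 2}].

Definition bvp_solution (p : R) (U : set R2) (s : {measure set M2 -> \bar R})
    (A : R2 -> 'M[R]_2) (x0 : R2) (f1 g : R2 -> R)
    (u : R2 -> R) (Du : R2 -> R2) : Prop :=
  [/\ W1p_grad p U u Du, is_trace p U s u Du g &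
      forall phi, test_function U phi ->
        \int[leb2]_(x in U) dot (mxv (A x) (Du x)) (grad phi x) =
          (\int[leb2]_(x in U) (f1 x * phi x)) + phi x0].

Definition f2 (x0 x : R2) : R2 :=
  (2 * pi)^-1 *: ((enorm (x - x0) ^+ 2)^-1 *: (x - x0)).

Definition flux (A : R2 -> 'M[R]_2) (x0 : R2) (Du : R2 -> R2) (x : R2) : R2 :=
  - mxv (A x) (Du x) - f2 x0 x.

Record mesh := Mesh { ncell : nat; vtx : 'I_ncell -> 'I_3 -> R2 }.

Definition hull (n : nat) (v : 'I_n -> R2) : set R2 :=
  [set x | exists w : 'I_n -> R, [/\ forall i, 0 <= w i, \sum_i w i = 1 &
             x = \sum_i w i *: v i]].
Definition segment (v w : R2) : set R2 :=
  [set x | exists t : R, [/\ 0 <= t, t <= 1 & x = (1 - t) *: v + t *: w]].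

Section Mesh.
Variable T : mesh.
Implicit Types k l : 'I_(ncell T).

Definition elem k : set R2 := hull (vtx k).
Definition hK k : R := diam (elem k).
Definition bary k : R2 := 3^-1 *: \sum_i vtx k i.

Definition nondegenerate k : Prop :=
  let a := vtx k 1 - vtx k 0 in let b := vtx k 2%:R - vtx k 0 in
  a.1 * b.2 - a.2 * b.1 != 0.

Definition conforming k l : Prop :=
  [\/ elem k `&` elem l = set0,
      (exists i j, vtx k i = vtx l j /\ elem k `&` elem l = [set vtx k i]) |
      (exists i j i' j', [/\ i != i', vtx k i = vtx l j, vtx k i' = vtx l j' &
         elem k `&` elem l = segment (vtx k i) (vtx k i')])].

Definition triangulation (U : set R2) : Prop :=
  [/\ forall k, nondegenerate k, \bigcup_(k in setT) elem k = closure U &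
      forall k l, k != l -> conforming k l].

Definition shape_regular (kap : R) : Prop :=
  forall k, exists y r, [/\ 0 < r, eball y r `<=` elem k & hK k <= kap * r].

Definition fitted (J : nat) (Om : 'I_J -> set R2) : Prop :=
  forall k, exists j, elem k `<=` closure (Om j).

Definition share_edge k l : Prop :=
  exists i j i' j', [/\ i != i', vtx k i = vtx l j & vtx k i' = vtx l j'].

Section Patch.
Variable S : {set 'I_(ncell T)}.

Definition patch_set : set R2 := \bigcup_(k in [set k | k \in S]) elem k.
Definition hpatch : R := \big[Num.max/0]_(k in S) hK k.

Definition edge_connected : Prop :=
  forall k l, k \in S -> l \in S ->
    connect [rel k l | [&& k \in S, l \in S & `[< share_edge k l >]]] k l.

Definition is_patch (x0 : R2) (m : nat) (kap : R) : Prop :=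
  [/\ forall k, elem k x0 -> k \in S, edge_connected, (#|S| <= m)%N,
      simeq kap (diam patch_set) hpatch &
      simeq kap (distpt x0 (bdry patch_set)) hpatch].

Definition graded (p rho0 c : R) (x0 : R2) (kap : R) : Prop :=
  [/\ forall k, elem k `<=` eball x0 rho0 ->
        simeq kap (hK k)
          (c * Num.max (enorm (bary k - x0)) hpatch `^ (2 * p / (p + 2))),
      (forall k, ~ elem k `<=` eball x0 rho0 -> simeq kap (hK k) c) &
      simeq kap hpatch (c `^ ((p + 2) / (2 - p)))].

End Patch.

Variables (U : set R2) (A : R2 -> 'M[R]_2).

(* Functions are taken up to null sets, hence the interiors of the elements. *)
Definition RT0 (tau : R2 -> R2) : Prop :=
  [/\ LpV leb2 2%:E U tau,
      (exists d, weak_div U tau d /\ Lp leb2 2%:E U d) &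
      forall k, exists (a : R2) (b : R),
        forall x, (elem k)° x -> tau x = a + b *: x].

Definition P0 (v : R2 -> R) : Prop :=
  measurable_fun (U : set M2) (v : M2 -> R) /\
  forall k, exists a, forall x, (elem k)° x -> v x = a.

Definition ipAV (rho tau : R2 -> R2) : R :=
  \int[leb2]_(x in U) dot (mxv (invmx (A x)) (rho x)) (tau x).

(* The duality pairing of the normal trace of [tau], with weak divergence [d],
   with the trace of [w], given by Green's formula. *)
Definition normal_pairing (tau : R2 -> R2) (d : R2 -> R)
    (w : R2 -> R) (Dw : R2 -> R2) : R :=
  \int[leb2]_(x in U) (dot (tau x) (Dw x) + d x * w x).

(* The pairing with the datum [g] is computed with any extension [w] of [g]
   into [U], and does not depend on it. *)
Definition mixed_solution (p : R) (s : {measure set M2 -> \bar R}) (x0 : R2)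
    (f1 g : R2 -> R) (sigh : R2 -> R2) (uh : R2 -> R) : Prop :=
  [/\ RT0 sigh, P0 uh,
      (forall tau d w Dw, RT0 tau -> weak_div U tau d ->
         W1p_grad p U w Dw -> is_trace p U s w Dw g ->
         ipAV sigh tau - (\int[leb2]_(x in U) (d x * uh x)) =
         - ipAV (f2 x0) tau - normal_pairing tau d w Dw) &
      (forall v d, P0 v -> weak_div U sigh d ->
         \int[leb2]_(x in U) (d x * v x) = \int[leb2]_(x in U) (f1 x * v x))].

Definition Kh (tau : R2 -> R2) : Prop := RT0 tau /\ weak_div U tau (cst 0).

Definition is_Rh (rho r : R2 -> R2) : Prop :=
  Kh r /\ forall tau, Kh tau -> ipAV r tau = ipAV rho tau.

End Mesh.

Definition partition_of (J : nat) (Om : 'I_J -> set R2) (U : set R2) : Prop :=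
  [/\ forall j, lipschitz_domain (Om j),
      (forall j, Om j `<=` U),
      (forall i j, i != j -> Om i `&` Om j = set0) &
      closure U = \bigcup_(j in setT) closure (Om j)].

(* No interface of [A] lies inside a subdomain: [A] has a continuous
   representative there. *)
Definition subordinate (J : nat) (Om : 'I_J -> set R2) (A : R2 -> 'M[R]_2) : Prop :=
  forall j, exists B : R2 -> 'M[R]_2,
    (forall i l, {in Om j, continuous (fun x => B x i l)}) /\
    {ae leb2, forall x, Om j x -> A x = B x}.

(* The point [x0] is removed from the subdomains: a field of size 1/|x - x0|
   has in general no locally integrable weak gradient near [x0]. *)
Definition broken_grad (J : nat) (Om : 'I_J -> set R2) (x0 : R2)
    (F : R2 -> R2) (G : R2 -> R2 * R2) : Prop :=
  forall j, weak_gradV (Om j `\ x0) F G.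

Section Estimate.
Variables (p : R) (T : mesh) (S : {set 'I_(ncell T)}).
Variable sig : R2 -> R2.

Definition elem_term (k : 'I_(ncell T)) : \bar R :=
  ((hK k)%:E * W1p_seminorm p (elem k)° sig)%E.

Definition elem_sum : \bar R :=
  (\sum_(k | k \notin S)
     (hK k `^ p)%:E * W1p_seminorm p (elem k)° sig `^ p)%E.

Definition source_term (U : set R2) (f1 : R2 -> R) : \bar R :=
  ((hpatch S)%:E * LpN leb2 p%:E (patch_set S `&` U) f1)%E.

Definition patch_term (Csig : R) : R := Csig * hpatch S `^ (2 / p - 1).

(* The bound on [elem_term k] given by a pointwise bound Csig |x - x0|^-2 on
   the gradient: an element of diameter h has area of order h^2. *)
Definition elem_bound (x0 : R2) (Csig : R) (k : 'I_(ncell T)) : R :=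
  hK k * (Csig * enorm (bary k - x0) `^ (- 2) * hK k `^ (2 / p)).

Definition flux_estimate (U : set R2) (f1 : R2 -> R) (Csig CSP Cf : R)
    (sigh : R2 -> R2) : Prop :=
  (LpN leb2 p%:E U (fun x => enorm (sig x - sigh x)%R) <=
   (Cf * (1 + CSP))%:E *
   ((patch_term Csig)%:E + source_term U f1 + elem_sum `^ p^-1))%E.

End Estimate.

End Plane.

Arguments leb2 {R}.
Arguments enorm {R} v.
Arguments frobnorm {R} M.

(* Main.v *)
Require Import Defs.
From HB Require Import structures.
From mathcomp Require Import all_boot all_order all_algebra.
From mathcomp Require Import all_classical all_reals all_analysis.
From mathcomp Require Import measurable_realfun ring lra.
Import Order.TTheory GRing.Theory Num.Theory.
Import numFieldNormedType.Exports.

(** The triangulation is graded so that everything balances at the scale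
    [c ^ nu] with [nu = 1 + 2 / p]. Write [mu = 2 p / (p + 2)] for the grading
    exponent, [gam = (p + 2) / (2 - p)] for the exponent of the patch size, [h0]
    for the size of the patch and [r] for the distance of an element from [x0].

    Patch and source: [gam (2 / p - 1) = nu] turns [h0 ^ (2 / p - 1)] into
    [c ^ nu], and [gam > nu] makes the source term of higher order.

    Elements: the patch contains a disk about [x0] of radius of order [h0], and
    elements outside the patch do not enter it ([elem_outside_dist]), because
    interiors of different elements are disjoint. Hence such an element has size
    of order [c r ^ mu], and all its points are at distances of order [r] from
    [x0] ([dist_bary]). Since the mesh is fitted to the partition and Lipschitz
    domains fill the interior of their closure, the broken gradient is a weak
    gradient on the element, of size [r ^ (-2)] there; the element has area of
    order [hK ^ 2], so its term is of order
    [hK ^ (1 + 2 / p) r ^ (-2) = c ^ nu r ^ (mu nu - 2) = c ^ nu]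
    ([elem_bound_simeq], [elem_pint_inner]). Elements that reach out of the disk
    [B_rho0] have in addition a part where only the L^p integrability of the
    gradient is known ([elem_pint_outer]).

    Number of elements: an element has area of order [hK ^ 2], so in a dyadic
    shell of radius [s] about [x0] there are at most of order
    [s ^ 2 / (c s ^ mu) ^ 2 = c ^ (-2) s ^ (2 - 2 mu)] elements, and the sum over
    the shells is geometric ([count_shell], [count_inner]). Conversely the
    elements have diameter at most of order [c] and cover the domain
    ([ncell_ge]).

    Rate: [N] terms of order [c ^ nu] have an l^p norm of order
    [N ^ (1 / p) c ^ nu], which is [c], that is, [N ^ (-1 / 2)]. The far part of
    the gradient adds [c] times a fixed L^p norm in total ([elem_sum_le],
    [flux_rate]). *)

Set Implicit Arguments.
Unset Strict Implicit.
Unset Printing Implicit Defensive.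
Local Open Scope classical_set_scope.
Local Open Scope ring_scope.

(** * The Euclidean norm of the plane *)

Section Enorm.
Variable R : realType.
Implicit Types x y z v w : R * R.

Lemma dotxx_ge0 v : 0 <= dot v v.
Proof. by rewrite /dot addr_ge0 // -expr2 sqr_ge0. Qed.

Lemma enorm_ge0 v : 0 <= enorm v.
Proof. exact: sqrtr_ge0. Qed.

Lemma sqr_enorm v : enorm v ^+ 2 = v.1 ^+ 2 + v.2 ^+ 2.
Proof. by rewrite sqr_sqrtr ?dotxx_ge0. Qed.

Lemma enormN v : enorm (- v) = enorm v.
Proof. by rewrite /enorm /dot /= !mulrNN. Qed.

Lemma enorm_distC x y : enorm (x - y) = enorm (y - x).
Proof. by rewrite -opprB enormN. Qed.

Lemma scale_pairE (a : R) v : a *: v = (a * v.1, a * v.2).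
Proof. by []. Qed.

Lemma enormZ (a : R) v : enorm (a *: v) = `|a| * enorm v.
Proof.
have h : dot (a *: v) (a *: v) = a ^+ 2 * dot v v.
  by rewrite /dot /=; rewrite /GRing.scale /=; ring.
by rewrite /enorm h sqrtrM ?sqr_ge0// sqrtr_sqr.
Qed.

Lemma le_fst_enorm v : `|v.1| <= enorm v.
Proof. by rewrite -ler_sqr ?nnegrE ?enorm_ge0// sqr_enorm real_normK ?num_real// lerDl sqr_ge0. Qed.

Lemma le_snd_enorm v : `|v.2| <= enorm v.
Proof. by rewrite -ler_sqr ?nnegrE ?enorm_ge0// sqr_enorm real_normK ?num_real// lerDr sqr_ge0. Qed.

Lemma enorm_le_sum v : enorm v <= `|v.1| + `|v.2|.
Proof.
rewrite -ler_sqr ?nnegrE ?enorm_ge0 ?addr_ge0// sqr_enorm sqrrD !real_normK ?num_real//.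
by rewrite -addrA [_ *+ 2 + _]addrC addrA lerDl mulrn_wge0// mulr_ge0.
Qed.

(** Cauchy-Schwarz, from Lagrange's identity. *)
Lemma ler_dot v w : `|dot v w| <= enorm v * enorm w.
Proof.
have e0 := enorm_ge0; rewrite /dot.
rewrite -ler_sqr ?nnegrE ?mulr_ge0// real_normK ?num_real// exprMn !sqr_enorm.
rewrite -subr_ge0.
suff -> : (v.1 ^+ 2 + v.2 ^+ 2) * (w.1 ^+ 2 + w.2 ^+ 2) -
  (v.1 * w.1 + v.2 * w.2) ^+ 2 = (v.1 * w.2 - v.2 * w.1) ^+ 2 by exact: sqr_ge0.
ring.
Qed.

Lemma ler_enormD v w : enorm (v + w) <= enorm v + enorm w.
Proof.
have e0 := enorm_ge0.
rewrite -ler_sqr ?nnegrE ?addr_ge0//.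
have cs := le_trans (ler_norm _) (ler_dot v w); rewrite /dot in cs.
have -> : (enorm v + enorm w) ^+ 2 =
   enorm v ^+ 2 + enorm w ^+ 2 + 2 * (enorm v * enorm w) by ring.
by rewrite !sqr_enorm /=; lra.
Qed.

Lemma ler_enorm_dist z x y : enorm (x - y) <= enorm (x - z) + enorm (z - y).
Proof. by rewrite (le_trans _ (ler_enormD _ _))// addrA subrK. Qed.

Lemma enorm_gt0 v : v != 0 -> 0 < enorm v.
Proof.
move=> v0; rewrite lt_neqAle enorm_ge0 andbT eq_sym; apply: contra v0 => /eqP e.
have := le_fst_enorm v; have := le_snd_enorm v; rewrite e !normr_le0.
by case: v {e} => a b /= /eqP-> /eqP->.
Qed.

(** Neighborhoods for the product topology can be handled through [enorm]. *)
Lemma nbhs_eball x (A : set (R * R)) :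
  nbhs x A <-> exists2 e : R, 0 < e & eball x e `<=` A.
Proof.
split=> [/nbhs_ballP[e /= e0 h]|[e e0 h]].
  exists e => // y ye; apply: h; split; rewrite /ball /= distrC.
    exact: (le_lt_trans (le_fst_enorm (y - x))).
  exact: (le_lt_trans (le_snd_enorm (y - x))).
apply/nbhs_ballP; exists (e / 2) => /=; first by rewrite divr_gt0.
move=> y [y1 y2]; apply: h; rewrite /eball /=.
apply: (le_lt_trans (enorm_le_sum _)) => /=.
move: y1 y2; rewrite /ball /= (distrC x.1) (distrC x.2); lra.
Qed.

Lemma eballxx x (e : R) : 0 < e -> eball x e x.
Proof. by rewrite /eball /= subrr /enorm /dot /= mul0r addr0 sqrtr0. Qed.

Lemma eball_open x (r : R) : open (eball x r).
Proof.
rewrite openE => y yr; apply/nbhs_eball; exists (r - enorm (y - x)).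
  by rewrite subr_gt0.
by move=> z zy; rewrite /eball /= (le_lt_trans (ler_enorm_dist y _ _))// -ltrBrDr.
Qed.

Lemma closure_eball x (r : R) : closure (eball x r) `<=` [set y | enorm (y - x) <= r].
Proof.
move=> y cy; rewrite /= leNgt; apply/negP => ry.
have [|z [zr zy]] := cy (eball y (enorm (y - x) - r)).
  by apply/nbhs_eball; exists (enorm (y - x) - r); rewrite ?subr_gt0.
have := ler_enorm_dist z y x; rewrite leNgt => /negP; apply.
by move: zr zy; rewrite /eball /= (enorm_distC z y) => zr zy; lra.
Qed.

Lemma bounded_eball (U : set (R * R)) x :
  bounded_set U -> exists2 D : R, 1 <= D & closure U `<=` [set y | enorm (y - x) <= D].
Proof.
move=> [M [_ hM]].
have h y : U y -> `|y| <= M + 1 by apply: (hM (M + 1)); rewrite ltrDl.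
exists (Num.max 1 (2 * (M + 1 + `|x|) + 1)); first by rewrite le_max lexx.
apply: subset_trans (@closure_eball x _); apply: closure_subset => y /h yM.
rewrite /eball /= lt_max; apply/orP; right.
have n1 (v : R * R) : `|v.1| <= `|v| /\ `|v.2| <= `|v|.
  by case: v => a b /=; rewrite prod_normE /= !le_max !lexx orbT.
have := n1 (y - x); have := ler_normB y x; have := enorm_le_sum (y - x).
move=> + + [+ +]; lra.
Qed.

End Enorm.

(** * Area *)

Section Area.
Variable R : realType.
Local Notation M2 := (measurableTypeR R * measurableTypeR R)%type.
Implicit Types x y z : R * R.

Definition rect (a b c d : R) : set (R * R) := `]a, b[ `*` `]c, d[.

Lemma measurable_rect a b c d : measurable (rect a b c d : set M2).
Proof. by apply: measurableX; exact: measurable_itv. Qed.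

Lemma leb2_rect a b c d : a <= b -> c <= d ->
  leb2 (rect a b c d) = ((b - a) * (d - c))%:E.
Proof.
move=> ab cd; rewrite /leb2 /rect [LHS]product_measure1E; [|exact: measurable_itv..].
have := lebesgue_measure_itv `]a, b[; have := lebesgue_measure_itv `]c, d[.
rewrite /= !lte_fin => -> ->.
move: ab cd; rewrite !le_eqVlt => /orP[/eqP->|ab] /orP[/eqP->|cd].
all: by rewrite ?ltxx ?ab ?cd ?subrr ?mul0e ?mule0 ?mul0r ?mulr0// EFinM !EFinB.
Qed.

(** The plane has a countable base of rational rectangles, so that the product
    sigma-algebra contains the open sets. *)
Lemma open_measurable2 (U : set (R * R)) : open U -> measurable (U : set M2).
Proof.
move=> oU.
pose rr (q : (rat * rat) * (rat * rat)) : set (R * R) :=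
  rect (ratr q.1.1) (ratr q.1.2) (ratr q.2.1) (ratr q.2.2).
pose F n : set (R * R) :=
  if unpickle n is Some q then (if `[< rr q `<=` U >] then rr q else set0) else set0.
suff -> : U = \bigcup_n F n.
  apply: bigcupT_measurable => n; rewrite /F; case: unpickle => [q|]; last exact: measurable0.
  by case: ifP => _; [exact: measurable_rect|exact: measurable0].
apply/seteqP; split => [x Ux|x [n _]]; last first.
  by rewrite /F; case: unpickle => // q; case: ifP => // /asboolP; exact.
have [e e0 eU] := (nbhs_eball x U).1 (open_nbhs_nbhs (conj oU Ux)).
have e2 : 0 < e / 2 by rewrite divr_gt0.
have [|a1] := @rat_in_itvoo R (x.1 - e / 2) x.1; first by lra.
have [|b1] := @rat_in_itvoo R x.1 (x.1 + e / 2); first by lra.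
have [|a2] := @rat_in_itvoo R (x.2 - e / 2) x.2; first by lra.
have [|b2] := @rat_in_itvoo R x.2 (x.2 + e / 2); first by lra.
rewrite !in_itv /= => /andP[p1 p2] /andP[p3 p4] /andP[p5 p6] /andP[p7 p8].
have [n nE] : exists n, unpickle n = Some ((a1, b1), (a2, b2)).
  by exists (pickle ((a1, b1), (a2, b2))); rewrite pickleK.
exists n; [by []|rewrite /F nE ifT].
  by split; rewrite /= in_itv /=; apply/andP; split.
apply/asboolP => y [] /=; rewrite !in_itv /= => /andP[q1 q2] /andP[q3 q4].
apply: eU; rewrite /eball /=; apply: (le_lt_trans (enorm_le_sum _)) => /=.
have : `|y.1 - x.1| < e / 2 by rewrite ltr_norml; apply/andP; split; lra.
have : `|y.2 - x.2| < e / 2 by rewrite ltr_norml; apply/andP; split; lra.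
lra.
Qed.

Lemma closed_measurable2 (U : set (R * R)) : closed U -> measurable (U : set M2).
Proof.
move=> cU; rewrite -[U]setCK; apply: measurableC; apply: open_measurable2.
exact: closed_openC.
Qed.

Lemma le_leb2 (U V : set (R * R)) : measurable (U : set M2) ->
  measurable (V : set M2) -> U `<=` V -> (leb2 U <= leb2 V)%E.
Proof. by move=> mU mV UV; apply: le_measure; rewrite ?inE. Qed.

Lemma leb2_le_square (U : set (R * R)) x r : measurable (U : set M2) -> 0 < r ->
  (forall y, U y -> enorm (y - x) < r) -> (leb2 U <= (4 * r ^+ 2)%:E)%E.
Proof.
move=> mU r0 Ur.
have -> : 4 * r ^+ 2 = ((x.1 + r) - (x.1 - r)) * ((x.2 + r) - (x.2 - r)) by ring.
rewrite -leb2_rect; [|lra..]; apply: le_leb2 => //; first exact: measurable_rect.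
move=> y /Ur yr; have y1 := le_lt_trans (le_fst_enorm _) yr.
have y2 := le_lt_trans (le_snd_enorm _) yr.
move: y1 y2; rewrite !ltr_norml /= => /andP[a1 a2] /andP[b1 b2].
by split; rewrite /= in_itv /=; apply/andP; split; lra.
Qed.

Lemma leb2_ge_square (U : set (R * R)) x r : measurable (U : set M2) -> 0 < r ->
  eball x r `<=` U -> ((r ^+ 2)%:E <= leb2 U)%E.
Proof.
move=> mU r0 Ur.
have -> : r ^+ 2 = ((x.1 + r / 2) - (x.1 - r / 2)) * ((x.2 + r / 2) - (x.2 - r / 2)).
  by field.
rewrite -leb2_rect; [|lra..]; apply: le_leb2 => //; first exact: measurable_rect.
move=> y [] /=; rewrite !in_itv /= => /andP[a1 a2] /andP[b1 b2].
apply: Ur; rewrite /eball /=; apply: (le_lt_trans (enorm_le_sum _)) => /=.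
have : `|y.1 - x.1| < r / 2 by rewrite ltr_norml; apply/andP; split; lra.
have : `|y.2 - x.2| < r / 2 by rewrite ltr_norml; apply/andP; split; lra.
lra.
Qed.

Definition circle x (r : R) : set (R * R) := [set y | enorm (y - x) = r].

Lemma closed_disk x (r : R) : closed [set y | enorm (y - x) <= r].
Proof.
rewrite -[X in closed X]setCK; apply: open_closedC; rewrite openE => y /= /negP.
rewrite -ltNge => ry; apply/nbhs_eball; exists (enorm (y - x) - r).
  by rewrite subr_gt0.
move=> z; rewrite /eball /= => zy; apply/negP; rewrite -ltNge.
by have := ler_enorm_dist z y x; rewrite (enorm_distC y z); lra.
Qed.

Lemma measurable_circle x r : measurable (circle x r : set M2).
Proof.
have -> : circle x r = [set y | enorm (y - x) <= r] `\` eball x r.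
  apply/seteqP; split => [y yr|y [/= yr /negP]].
    by split; rewrite /= ?/eball /= (yr : enorm (y - x) = r) ?lexx ?ltxx.
  by rewrite -leNgt => ry; apply/eqP; rewrite eq_le yr.
apply: measurableD; first by apply: closed_measurable2; exact: closed_disk.
by apply: open_measurable2; exact: eball_open.
Qed.

(** A vertical line meets a circle in at most two points. *)
Lemma leb2_circle x r : leb2 (circle x r) = 0%E.
Proof.
rewrite /leb2 /= /product_measure1 integral0_eq// => s _ /=.
apply: countable_lebesgue_measure0.
pose q := Num.sqrt (r ^+ 2 - (s - x.1) ^+ 2).
apply: (@sub_countable _ _ _ [set x.2 + q; x.2 - q]); last first.
  exact/finite_set_countable/finite_set2.
apply: subset_card_le => t; rewrite /xsection /= inE => st.
have : (t - x.2) ^+ 2 = q ^+ 2.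
  have := sqr_enorm ((s, t) - x); rewrite st /= => rE.
  have tE : (t - x.2) ^+ 2 = r ^+ 2 - (s - x.1) ^+ 2 by rewrite rE; ring.
  by rewrite /q sqr_sqrtr -tE// sqr_ge0.
by move/eqP; rewrite eqf_sqr => /orP[]/eqP h; [left|right]; rewrite -h; ring.
Qed.

End Area.

(** * Integrals of p-th powers *)

Section LpNorm.
Variables (R : realType) (p : R).
Hypothesis p_gt0 : 0 < p.
Local Notation M2 := (measurableTypeR R * measurableTypeR R)%type.
Implicit Types (U V : set (R * R)) (f : R * R -> R).

(** The [p]-th power of the L^p norm; unlike the norm, it is additive in [U]. *)
Definition pint U f : \bar R := (\int[leb2]_(x in U) (`|f x| `^ p)%:E)%E.

Lemma pint_ge0 U f : (0 <= pint U f)%E.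
Proof. by apply: integral_ge0 => x _; rewrite lee_fin powR_ge0. Qed.

Lemma LpNE U f : LpN leb2 p%:E U f = (pint U f `^ p^-1)%E.
Proof.
rewrite /LpN unlock /Lnorm /pint [in RHS]integral_mkcond; congr (_ `^ _)%E.
apply: eq_integral => x _ /=; rewrite /patch; case: ifP => _ //=.
by rewrite normr0 powR0// gt_eqF.
Qed.

Lemma LpN_poweR U f : (LpN leb2 p%:E U f `^ p = pint U f)%E.
Proof.
by rewrite LpNE -poweRrM mulVf ?gt_eqF// poweRe1// pint_ge0.
Qed.

Lemma LpN_lty U f : (LpN leb2 p%:E U f < +oo)%E -> (pint U f < +oo)%E.
Proof. by move=> h; rewrite -LpN_poweR poweR_lty. Qed.

Lemma measurable_pow_norm U f : measurable (U : set M2) ->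
  measurable_fun (U : set M2) (f : M2 -> R) ->
  measurable_fun (U : set M2) (EFin \o (fun x : M2 => `|f x| `^ p)).
Proof.
move=> mU mf; apply/measurable_EFinP.
apply: (measurableT_comp (measurable_powR p)) => //.
exact: measurableT_comp.
Qed.

Lemma le_pint U V f : measurable (U : set M2) -> measurable (V : set M2) ->
  measurable_fun (V : set M2) (f : M2 -> R) -> U `<=` V -> (pint U f <= pint V f)%E.
Proof.
move=> mU mV mf UV; apply: ge0_subset_integral => //.
exact: measurable_pow_norm.
Qed.

Lemma ae_leb2S (P Q : set (R * R)) : P `<=` Q ->
  {ae leb2, forall x, P x} -> {ae leb2, forall x, Q x}.
Proof. by move=> PQ; apply: (@filterS _ _ (ae_filter_ringOfSetsType leb2)). Qed.

Lemma ae_leb2I (P Q : set (R * R)) : {ae leb2, forall x, P x} ->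
  {ae leb2, forall x, Q x} -> {ae leb2, forall x, P x /\ Q x}.
Proof. exact: (@filterI _ _ (ae_filter_ringOfSetsType leb2)). Qed.

Lemma pint_le_cst U f (B : R) : measurable (U : set M2) ->
  measurable_fun (U : set M2) (f : M2 -> R) -> 0 <= B ->
  {ae leb2, forall x, U x -> `|f x| <= B} ->
  (pint U f <= (B `^ p)%:E * leb2 U)%E.
Proof.
move=> mU mf B0 fB; rewrite -integral_cst//; apply: ae_ge0_le_integral => //.
- exact: measurable_pow_norm.
- by move=> x _; rewrite /= lee_fin powR_ge0.
- apply: ae_leb2S fB => x /[apply] fB; rewrite lee_fin ge0_ler_powR ?nnegrE//.
  exact: ltW.
Qed.

End LpNorm.

(** * Triangles *)

Section Diameter.
Variable R : realType.
Implicit Types (x y : R * R) (E : set (R * R)).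

Lemma ler_diam E (M : R) x y : (forall x y, E x -> E y -> enorm (x - y) <= M) ->
  E x -> E y -> enorm (x - y) <= diam E.
Proof.
move=> EM Ex Ey; apply: ub_le_sup; last by exists x, y.
by exists M => _ [x' [y' [Ex' Ey' ->]]]; exact: EM.
Qed.

Lemma diam_le E (M : R) x : (forall x y, E x -> E y -> enorm (x - y) <= M) ->
  E x -> diam E <= M.
Proof.
move=> EM Ex; apply: ge_sup; first by exists (enorm (x - x)), x, x.
by move=> _ [x' [y' [Ex' Ey' ->]]]; exact: EM.
Qed.

End Diameter.

Section Triangles.
Variables (R : realType) (T : mesh R).
Implicit Types (k l : 'I_(ncell T)) (x y : R * R).

Lemma sum_ord3 (V : zmodType) (F : 'I_3 -> V) : \sum_i F i = F 0 + F 1 + F 2%:R.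
Proof.
rewrite !big_ord_recl big_ord0 addr0 addrA; congr (_ + _ + _); congr F; exact: val_inj.
Qed.

(** Barycentric coordinates with respect to the second and third vertices, by
    Cramer's rule. *)
Definition cross x y : R := x.1 * y.2 - x.2 * y.1.
Definition side k (i : 'I_3) : R * R := vtx k i - vtx k 0.
Definition bary1 k x : R :=
  cross (x - vtx k 0) (side k 2%:R) / cross (side k 1) (side k 2%:R).
Definition bary2 k x : R :=
  cross (side k 1) (x - vtx k 0) / cross (side k 1) (side k 2%:R).

Lemma bary_coordE k x : Defs.nondegenerate k ->
  x = (1 - bary1 k x - bary2 k x) *: vtx k 0 + bary1 k x *: vtx k 1
      + bary2 k x *: vtx k 2%:R.
Proof.
rewrite /Defs.nondegenerate /bary1 /bary2 /cross /side.
case: x (vtx k 0) (vtx k 1) (vtx k 2%:R) => [x1 x2] [a1 a2] [b1 b2] [c1 c2] /= D0.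
by rewrite !scale_pairE /=; congr pair => /=; field.
Qed.

Lemma bary_coord_comb k (w1 w2 : R) : Defs.nondegenerate k ->
  let x := (1 - w1 - w2) *: vtx k 0 + w1 *: vtx k 1 + w2 *: vtx k 2%:R in
  bary1 k x = w1 /\ bary2 k x = w2.
Proof.
move=> + x; rewrite {}/x !scale_pairE.
rewrite /Defs.nondegenerate /bary1 /bary2 /cross /side.
case: (vtx k 0) (vtx k 1) (vtx k 2%:R) => [a1 a2] [b1 b2] [c1 c2] /= D0.
by split; field.
Qed.

Lemma elemP k x : Defs.nondegenerate k ->
  elem k x <-> [/\ 0 <= bary1 k x, 0 <= bary2 k x & bary1 k x + bary2 k x <= 1].
Proof.
move=> nd; split => [[w [w0]]|[h1 h2 h3]].
  rewrite !sum_ord3 => w1 ->.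
  have -> : w 0 = 1 - w 1 - w 2%:R by rewrite -w1; ring.
  have [-> ->] := bary_coord_comb (w 1) (w 2%:R) nd; split => //.
  by have := w0 0; lra.
exists (fun i => if i == 0 then 1 - bary1 k x - bary2 k x else
                 if i == 1 then bary1 k x else bary2 k x); split.
- by move=> i; case: ifP => _; [|case: ifP => _]; lra.
- by rewrite sum_ord3 /=; ring.
- by rewrite sum_ord3 /=; exact: bary_coordE.
Qed.

Lemma continuous_bary1 k : continuous (bary1 k).
Proof.
move=> x; rewrite /bary1 /cross /=; apply: cvgM; last exact: cvg_cst.
by apply: cvgB; (apply: cvgM; last exact: cvg_cst);
  (apply: cvgB; last exact: cvg_cst); [exact: cvg_fst|exact: cvg_snd].
Qed.

Lemma continuous_bary2 k : continuous (bary2 k).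
Proof.
move=> x; rewrite /bary2 /cross /=; apply: cvgM; last exact: cvg_cst.
by apply: cvgB; (apply: cvgM; first exact: cvg_cst);
  (apply: cvgB; last exact: cvg_cst); [exact: cvg_snd|exact: cvg_fst].
Qed.

Lemma continuous_bary12 k : continuous (fun x => bary1 k x + bary2 k x).
Proof. by move=> x; apply: cvgD; [exact: continuous_bary1|exact: continuous_bary2]. Qed.

Lemma elem_closed k : Defs.nondegenerate k -> closed (elem k).
Proof.
move=> nd.
have -> : elem k = bary1 k @^-1` [set t | 0 <= t] `&` bary2 k @^-1` [set t | 0 <= t]
  `&` (fun x => bary1 k x + bary2 k x) @^-1` [set t | t <= 1].
  by apply/seteqP; split => x; [move/(elemP x nd) => []|move=> [[? ?] ?]; apply/(elemP x nd)].
apply: closedI; first apply: closedI.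
- by apply: closed_comp (@closed_ge R 0) => x _; exact: continuous_bary1.
- by apply: closed_comp (@closed_ge R 0) => x _; exact: continuous_bary2.
- by apply: closed_comp (@closed_le R 1) => x _; exact: continuous_bary12.
Qed.

Lemma bary_elem k : Defs.nondegenerate k -> (elem k)° (bary k).
Proof.
move=> nd.
have bE : bary k = (1 - 3^-1 - 3^-1) *: vtx k 0 + 3^-1 *: vtx k 1 + 3^-1 *: vtx k 2%:R.
  by rewrite /bary sum_ord3 !scalerDr; congr (_ *: _ + _ + _); field.
have [b1 b2] := bary_coord_comb 3^-1 3^-1 nd.
have near1 (f : R * R -> R) : continuous f -> 0 < f (bary k) ->
    \forall x \near bary k, 0 < f x.
  by move=> cf f0; exact: (cvgr_gt _ (cf _)).
have h1 := near1 _ (@continuous_bary1 k); have h2 := near1 _ (@continuous_bary2 k).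
have h3 := near1 (fun x => 1 - (bary1 k x + bary2 k x)).
rewrite -bE in b1 b2; rewrite b1 in h1; rewrite b2 in h2; rewrite b1 b2 in h3.
have {}h1 := h1 ltac:(by lra); have {}h2 := h2 ltac:(by lra).
have {}h3 := h3 (fun x => cvgB (cvg_cst _) (@continuous_bary12 k x)) ltac:(by lra).
rewrite /interior /=; near=> x; apply/(elemP x nd); split.
- by apply/ltW; near: x.
- by apply/ltW; near: x.
- by rewrite -subr_ge0; apply/ltW; near: x.
Unshelve. all: by end_near.
Qed.

(** Three non-collinear points fit into any open set. *)
Lemma open_segment_set0 (V : set (R * R)) v w :
  open V -> V `<=` segment v w -> V = set0.
Proof.
move=> oV Vs; rewrite -subset0 => x Vx.
have [e e0 eV] := (nbhs_eball x V).1 (open_nbhs_nbhs (conj oV Vx)).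
have e2 : 0 < e / 2 by rewrite divr_gt0.
have mV (a b : R) : `|a| + `|b| <= e / 2 -> segment v w (x + (a, b)).
  move=> ab; apply/Vs/eV; rewrite /eball /= addrC addKr.
  by apply: (le_lt_trans (enorm_le_sum _)) => /=; lra.
have e2W := ltW e2; have ne2 : `|e / 2| = e / 2 by rewrite gtr0_norm.
have [s0 [_ _]] := mV 0 0 ltac:(by rewrite normr0 addr0).
have [s1 [_ _]] := mV (e / 2) 0 ltac:(by rewrite normr0 ne2 addr0).
have [s2 [_ _]] := mV 0 (e / 2) ltac:(by rewrite normr0 ne2 add0r).
rewrite !scale_pairE; case: x v w {Vx eV mV Vs} => [x1 x2] [v1 v2] [w1 w2] /=.
move=> [p1 p2] [q1 q2] [r1 r2].
have := mulf_neq0 (lt0r_neq0 e2) (lt0r_neq0 e2); move/eqP; apply.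
have d1 : e / 2 = (s1 - s0) * (w1 - v1) by lra.
have d2 : 0 = (s1 - s0) * (w2 - v2) by lra.
have d3 : e / 2 = (s2 - s0) * (w2 - v2) by lra.
rewrite {1}d1 d3.
have -> : (s1 - s0) * (w1 - v1) * ((s2 - s0) * (w2 - v2)) =
  (s1 - s0) * (w2 - v2) * ((w1 - v1) * (s2 - s0)) by ring.
by rewrite -d2 mul0r.
Qed.

Lemma disjoint_elem k l : conforming k l -> (elem k)° `&` (elem l)° = set0.
Proof.
move=> ckl.
have oI : open ((elem k)° `&` (elem l)°) by apply: openI; exact: open_interior.
have sI : (elem k)° `&` (elem l)° `<=` elem k `&` elem l.
  by apply: setISS; exact: interior_subset.
case: ckl => [e0|[i [j [_ e1]]]|[i [j [i' [j' [_ _ _ e2]]]]]].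
- by rewrite -subset0 -e0.
- apply: (@open_segment_set0 _ (vtx k i) (vtx k i)) => //.
  apply: subset_trans sI _; rewrite e1 => _ ->; exists 0; split=> //.
  by rewrite subr0 scale1r scale0r addr0.
- apply: (@open_segment_set0 _ (vtx k i) (vtx k i')) => //.
  by rewrite -e2.
Qed.

(** If the first set does not contain the open set, removing it leaves a nonempty
    open set that the other sets cover. *)
Lemma open_cover_interior (I : eqType) (F : I -> set (R * R)) (s : seq I)
    (V : set (R * R)) : (forall i, closed (F i)) -> open V -> V !=set0 ->
  V `<=` [set x | exists2 i, i \in s & F i x] ->
  exists2 i, i \in s & (V `&` (F i)°) !=set0.
Proof.
move=> cF; elim: s V => [|i s IH] V oV [x Vx] Vs; first by have [] := Vs _ Vx.
have [VF|/existsNP[y /not_implyP[Vy Fy]]] := pselect (V `<=` F i).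
  exists i; first exact: mem_head.
  exists x; split=> //; exact: (filterS VF (open_nbhs_nbhs (conj oV Vx))).
have [||z [Vz Fz]|j js [z [[Vz _] jz]]] := IH (V `&` ~` F i).
- by apply: openI => //; exact: closed_openC.
- by exists y.
- have [j] := Vs _ Vz; rewrite in_cons => /orP[/eqP->//|js Fj]; by exists j.
- by exists j; [rewrite in_cons js orbT|exists z].
Qed.

End Triangles.

(** * Triangulations and the patch *)

Section MeshGeometry.
Variables (R : realType) (T : mesh R) (Om : set (R * R)) (x0 : R * R) (D : R).
Hypothesis triT : triangulation T Om.
Hypothesis closure_le : closure Om `<=` [set x | enorm (x - x0) <= D].
Local Notation M2 := (measurableTypeR R * measurableTypeR R)%type.
Implicit Types (k l : 'I_(ncell T)) (x y : R * R) (S : {set 'I_(ncell T)}).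

Lemma mesh_nondegenerate k : Defs.nondegenerate k.
Proof. by case: triT. Qed.

Lemma elem_sub_closure k : elem k `<=` closure Om.
Proof. by case: triT => _ <- _ x kx; exists k. Qed.

Lemma elem_dist k x : elem k x -> enorm (x - x0) <= D.
Proof. by move/elem_sub_closure/closure_le. Qed.

Lemma interior_elem_sub k : (elem k)° `<=` elem k.
Proof. exact: interior_subset. Qed.

Lemma measurable_elem_interior k : measurable ((elem k)° : set M2).
Proof. by apply: open_measurable2; exact: open_interior. Qed.

Lemma elem_diam_le k x y : elem k x -> elem k y -> enorm (x - y) <= 2 * D.
Proof.
move=> /elem_dist kx /elem_dist ky; apply: (le_trans (ler_enorm_dist x0 _ _)).
by rewrite (enorm_distC x0); lra.
Qed.

Lemma le_hK k x y : elem k x -> elem k y -> enorm (x - y) <= hK k.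
Proof. by apply: ler_diam; exact: elem_diam_le. Qed.

Lemma bary_in k : elem k (bary k).
Proof. exact/interior_elem_sub/bary_elem/mesh_nondegenerate. Qed.

Lemma hK_le k : hK k <= 2 * D.
Proof. by apply: (diam_le _ (bary_in k)); exact: elem_diam_le. Qed.

Lemma hpatch_le S : 0 <= D -> hpatch S <= 2 * D.
Proof.
move=> D0; apply/bigmax_leP; split; first by rewrite mulr_ge0.
by move=> k _; exact: hK_le.
Qed.

Lemma trivIset_elem (I : set 'I_(ncell T)) : trivIset I (fun k => (elem k)°).
Proof.
apply/trivIsetP => k l _ _ kl; apply: disjoint_elem.
by case: triT => _ _; apply.
Qed.

Lemma closed_patch S : closed (patch_set S).
Proof.
apply: closed_bigcup; first exact: finite_finset.
by move=> k _; apply/elem_closed/mesh_nondegenerate.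
Qed.

Section Patch.
Variable S : {set 'I_(ncell T)}.
Hypotheses (oOm : open Om) (x0Om : Om x0).
Hypothesis x0S : forall k, elem k x0 -> k \in S.
Local Notation d := (distpt x0 (bdry (patch_set S))).

(** The elements outside the patch are finitely many closed sets that miss
    [x0]. *)
Lemma patch_interior_center : (patch_set S)° x0.
Proof.
have far k : \forall x \near x0, k \notin S -> ~ elem k x.
  have [kS|kS] := boolP (k \in S).
    by apply: (@nearW _ (nbhs x0) _ (nbhs_filter x0)).
  have: nbhs x0 (~` elem k).
    apply: open_nbhs_nbhs; split; first exact/closed_openC/elem_closed/mesh_nondegenerate.
    by move=> /x0S; rewrite (negbTE kS).
  by apply: (@filterS _ (nbhs x0) (nbhs_filter x0)).
have nOm : nbhs x0 Om by apply: open_nbhs_nbhs.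
rewrite /interior /=; apply: (@filterS2 _ (nbhs x0) (nbhs_filter x0) _ _ _ _ (@filter_forall _ _ _ (nbhs x0) (nbhs_filter x0) far) nOm) => x Sx Omx.
have : closure Om x by exact: subset_closure.
case: triT => _ <- _ [k _ kx]; exists k => //=.
by apply: contrapT => /negP/Sx.
Qed.

(** A segment from [x0] that leaves the interior of the patch meets its
    boundary. *)
Lemma eball_sub_patch : eball x0 d `<=` (patch_set S)°.
Proof.
move=> y yd; pose gam (t : R) : R * R := x0 + t *: (y - x0).
have cgam : continuous gam.
  by move=> t; apply: cvgD; [exact: cvg_cst|apply: cvgZ; [exact: cvg_id|exact: cvg_cst]].
pose Q := (patch_set S)°.
have gamd t : t \in `[0, 1] -> enorm (x0 - gam t) < d.
  rewrite in_itv /= => /andP[t0 t1]; rewrite enorm_distC addrC addKr enormZ ger0_norm//.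
  by apply: le_lt_trans yd; rewrite ler_piMl ?enorm_ge0.
have nb t : t \in `[0, 1] -> ~ bdry (patch_set S) (gam t).
  move=> /gamd; rewrite ltNge => /negP h b; apply: h; apply: ge_inf; last by exists (gam t).
  by exists 0 => _ [z _ <-]; exact: enorm_ge0.
have h : `[0, 1] `&` gam @^-1` Q = `[0, 1]%classic.
  apply: (@segment_connected R 0 1).
  - exists 0; split; rewrite /= ?in_itv /= ?lexx ?ler01//.
    by rewrite /gam scale0r addr0; exact: patch_interior_center.
  - by exists (gam @^-1` Q) => //; apply: open_comp; [by move=> t _; exact: cgam|by rewrite /Q; exact: open_interior].
  - exists (gam @^-1` patch_set S).
      by apply: closed_comp; [by move=> t _; exact: cgam|exact: closed_patch].
    apply/seteqP; split => t [t01 gt]; split => //; first exact: (interior_subset gt).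
    apply: contrapT => nQ; apply: (nb t t01); split => //; exact: (@subset_closure _ (patch_set S) (gam t) gt).
have : [set` `[0, 1]] (1 : R) by rewrite /= in_itv /= ler01 lexx.
by rewrite -h => -[_]; rewrite /gam /= scale1r addrC subrK.
Qed.

(** Elements outside the patch cannot enter the ball inside the patch, because
    their interiors are disjoint from those of the patch elements. *)
Lemma elem_outside_dist k x : k \notin S -> (elem k)° x -> d <= enorm (x - x0).
Proof.
move=> kS kx; rewrite leNgt; apply/negP => xd.
pose V := eball x0 d `&` (elem k)°.
have oV : open V by apply: openI; [exact: eball_open|exact: open_interior].
have cF l : closed (elem l) by apply/elem_closed/mesh_nondegenerate.
have [||l lS [z [[_ kz] lz]]] := @open_cover_interior R _ (fun l => elem l) (enum S) V cF oV.
- by exists x.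
- by move=> y [/eball_sub_patch/interior_subset [l /= lS ly] _]; exists l; rewrite ?mem_enum.
have kl : k != l by apply: contraNneq kS => ->; rewrite mem_enum in lS.
have := @trivIset_elem setT; move/trivIsetP => /(_ k l I I kl) h.
by have : (set0 : set (R * R)) z by rewrite -h.
Qed.

End Patch.

Lemma leb2_elem_le k : 0 < hK k -> (leb2 (elem k)° <= (16 * hK k ^+ 2)%:E)%E.
Proof.
move=> h0; have -> : 16 * hK k ^+ 2 = 4 * (2 * hK k) ^+ 2 by ring.
apply: (leb2_le_square (x := bary k)); [exact: measurable_elem_interior|lra|].
by move=> y /interior_elem_sub ky; have := le_hK ky (bary_in k); lra.
Qed.

(** The inscribed disk of a shape-regular element has radius of the order of the
    diameter. *)
Lemma leb2_elem_ge (kap : R) k : 0 < kap -> 0 <= hK k -> shape_regular T kap ->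
  (((hK k / kap) ^+ 2)%:E <= leb2 (elem k)°)%E.
Proof.
move=> kap0 h0 /(_ k) [y [r [r0 yr hr]]].
apply: (@le_trans _ _ (r ^+ 2)%:E).
  have [r0W kW] := (ltW r0, ltW kap0).
  by rewrite lee_fin lerXn2r ?nnegrE ?divr_ge0// ler_pdivrMr// mulrC.
apply: (leb2_ge_square (x := y)) => //; first exact: measurable_elem_interior.
by rewrite -open_subsetE//; exact: eball_open.
Qed.

(** Since the elements have disjoint interiors, their areas add up to at most
    the area of any set that contains them. *)
Lemma packing (I : {set 'I_(ncell T)}) (B : set (R * R)) (m b : R) :
  measurable (B : set M2) -> (leb2 B <= b%:E)%E ->
  (forall k, k \in I -> (elem k)° `<=` B) ->
  (forall k, k \in I -> (m%:E <= leb2 (elem k)°)%E) -> #|I|%:R * m <= b.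
Proof.
move=> mB Bb IB Im; rewrite -lee_fin; apply: le_trans Bb.
apply: (@le_trans _ _ (leb2 (\big[setU/set0]_(k in I) (elem k)°))).
  rewrite measure_bigsetU_ord_cond; last 2 first.
    by move=> k _; exact: measurable_elem_interior.
    exact: trivIset_elem.
  rewrite mulr_natl -sumr_const -sumEFin; apply: lee_sum => k; exact: Im.
apply: le_leb2 => //.
  by apply: bigsetU_measurable => k _; exact: measurable_elem_interior.
by elim/big_ind: _ => [x //|U V UB VB x [/UB|/VB]//|k kI]; exact: IB.
Qed.

(** Each element lies in a disk of radius [2 * h] about its barycenter. *)
Lemma covering (h : R) : 0 < h -> open Om -> (forall k, hK k <= h) ->
  (leb2 Om <= ((ncell T)%:R * (16 * h ^+ 2))%:E)%E.
Proof.
move=> h0 oOm hh; pose sq k : set (R * R) := eball (bary k) (2 * h).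
have msq k : measurable (sq k : set M2) by apply: open_measurable2; exact: eball_open.
have Omsq : Om `<=` \big[setU/set0]_(k < ncell T) sq k.
  move=> x /subset_closure; case: triT => _ <- _ [k _ kx].
  rewrite (bigD1 k)//=; left; rewrite /sq /eball /=.
  by have := le_hK kx (bary_in k); have := hh k; lra.
apply: (@le_trans _ _ (leb2 (\big[setU/set0]_(k < ncell T) sq k))).
  apply: le_leb2 => //; first exact: open_measurable2.
  by apply: bigsetU_measurable => k _.
apply: (@le_trans _ _ (\sum_(k < ncell T) leb2 (sq k))%E).
  apply: (proj2 (A := measurable (\big[setU/set0]_(k < ncell T) sq k : set M2))).
  apply: (big_ind2 (fun (A : set M2) a => measurable A /\ (leb2 A <= a)%E)).
  - by rewrite measure0; split; [exact: measurable0|].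
  - move=> A a B b [mA Aa] [mB Bb]; split; first exact: measurableU.
    exact: le_trans (measureU2 _ mA mB) (leeD Aa Bb).
  - by move=> k _; split.
rewrite mulr_natl -[X in _ *+ X]card_ord -sumr_const -sumEFin; apply: lee_sum => k _.
have -> : 16 * h ^+ 2 = 4 * (2 * h) ^+ 2 by ring.
by apply: (leb2_le_square (x := bary k)) => //; lra.
Qed.

End MeshGeometry.

(** * Weak gradients *)

Section WeakGradients.
Variable R : realType.
Local Notation M2 := (measurableTypeR R * measurableTypeR R)%type.
Implicit Types (U V : set (R * R)) (v : R * R -> R).

(** Below the graph that bounds [U] near a boundary point there are points
    arbitrarily close to it that are not adherent to [U]. *)
Lemma lipschitz_interior_closure U : lipschitz_domain U -> (closure U)° `<=` U.
Proof.
move=> [[oU _ _] lU] z zU; apply: contrapT => nUz.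
have bz : bdry U z.
  by split; [exact: interior_subset zU|rewrite (iffLR (interior_id U) oU)].
have [e [r [L [psi [e1 r0 Lpsi hU]]]]] := lU z bz.
pose f := ((- e.2, e.1) : R * R).
have dot0 w : dot w (z - z) = 0 by rewrite subrr /dot /= !mulr0 addr0.
have psi0 : 0 <= psi 0.
  by rewrite leNgt; apply/negP => h; apply: nUz; apply/hU; [exact: eballxx|rewrite !dot0].
have [d d0 dU] := (nbhs_eball z _).1 zU.
pose t := Num.min d r / 2.
have m0 : 0 < Num.min d r by rewrite lt_min d0.
have t0 : 0 < t by rewrite divr_gt0.
have [td tr] : t < d /\ t < r.
  have : t < Num.min d r by rewrite /t; lra.
  by rewrite lt_min => /andP.
pose y := z - t *: e.
have yz : enorm (y - z) = t by rewrite /y addrC addKr enormN enormZ e1 mulr1 gtr0_norm.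
have {}dU : closure U y by apply: dU; rewrite /eball /= yz.
(* Points within distance [s] of [y] have height at most [s - t], while there the
   graph is above [- `|L| * s]; [s] is chosen so that the former is smaller. *)
pose s := Num.min (r - t) (t / (1 + `|L|)) / 2.
have L1 : 0 < 1 + `|L| by rewrite ltr_wpDr.
have ms0 : 0 < Num.min (r - t) (t / (1 + `|L|)) by rewrite lt_min subr_gt0 tr divr_gt0.
have s0 : 0 < s by rewrite divr_gt0.
have [sr st] : s < r - t /\ s < t / (1 + `|L|).
  have : s < Num.min (r - t) (t / (1 + `|L|)) by rewrite /s; lra.
  by rewrite lt_min => /andP.
have [|x [Ux xy]] := dU (eball y s); first by apply/nbhs_eball; exists s.
rewrite /eball /= in xy.
have xr : eball z r x.
  by rewrite /eball /=; have := ler_enorm_dist y x z; rewrite yz; lra.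
have dE (w : R * R) : dot w (x - z) = dot w (x - y) - t * dot w e.
  by rewrite /dot /y scale_pairE /=; ring.
have ee : dot e e = 1 by rewrite /dot -!expr2 -sqr_enorm e1 expr1n.
have fe : dot f e = 0 by rewrite /dot /f /=; ring.
have cs (w : R * R) : enorm w = 1 -> `|dot w (x - y)| <= s.
  by move=> w1; rewrite (le_trans (ler_dot _ _))// w1 mul1r ltW.
have f1 : enorm f = 1 by rewrite -e1 /enorm /dot /f /= mulrNN addrC.
have := (hU x xr).1 Ux; rewrite -/f !dE ee fe mulr0 subr0 mulr1.
have := cs _ e1; have := cs _ f1; have := Lpsi (dot f (x - y)) 0; rewrite subr0.
move=> h1 h2 h3 h4.
have h5 : L * `|dot f (x - y)| <= `|L| * s.
  apply: (@le_trans _ _ (`|L| * `|dot f (x - y)|)).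
    by rewrite ler_wpM2r// ler_norm.
  by rewrite ler_wpM2l.
have st' : (1 + `|L|) * s < t by rewrite mulrC -ltr_pdivlMr.
have := le_trans h1 h5; rewrite ler_norml => /andP[h6 _].
have := ler_norm (dot e (x - y)); lra.
Qed.

Lemma derive_near0 (f : R * R -> R) x w : (\forall y \near x, f y = 0) -> 'D_w f x = 0.
Proof.
by move=> f0; rewrite (near_eq_derive (g := cst 0))// derive_cst.
Qed.

Lemma test_functionS U V phi : V `<=` U -> test_function V phi -> test_function U phi.
Proof.
move=> VU [sphi [Q [cQ QV phi0]]]; split=> //; exists Q; split=> //.
exact: subset_trans VU.
Qed.

(** A test function vanishes near every point outside its compact support. *)
Lemma pd_test_function V phi x : test_function V phi -> ~ V x ->
  [/\ phi x = 0, pd1 phi x = 0 & pd2 phi x = 0].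
Proof.
move=> [_ [Q [cQ QV phi0]]] Vx.
have Qx : ~ Q x by move/QV.
have n0 : \forall y \near x, phi y = 0.
  have nQ : nbhs x (~` Q).
    apply: open_nbhs_nbhs; split => //; apply: closed_openC.
    by apply: compact_closed => //; exact: norm_hausdorff.
  by apply: (@filterS _ (nbhs x) (nbhs_filter x)) nQ => y; exact: phi0.
by split; [exact: phi0|exact: derive_near0..].
Qed.

Lemma Rintegral_zero_off U V (f : M2 -> R) : V `<=` U ->
  (forall x, U x -> ~ V x -> f x = 0) ->
  \int[leb2]_(x in U) f x = \int[leb2]_(x in V) f x.
Proof.
move=> VU f0; rewrite /Rintegral; congr fine.
rewrite integral_mkcond [RHS]integral_mkcond; apply: eq_integral => x _.
rewrite /patch; case: ifPn => xU; case: ifPn => // xV.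
- by rewrite inE in xU; rewrite notin_setE in xV; rewrite f0.
- by rewrite inE in xV; move: xU; rewrite notin_setE => /(_ (VU _ xV)).
Qed.

Lemma loc_integrableS U V v : open U -> V `<=` U ->
  loc_integrable U v -> loc_integrable V v.
Proof.
move=> oU VU [mv iv]; split.
  by apply: measurable_funS mv => //; exact: open_measurable2.
by move=> Q cQ QV; apply: iv => //; exact: subset_trans VU.
Qed.

(** Test functions on [V] extended by zero are test functions on [U]. *)
Lemma weak_gradS U V v G : open U -> V `<=` U -> weak_grad U v G -> weak_grad V v G.
Proof.
move=> oU VU [lv l1 l2 h]; split; [exact: loc_integrableS lv|exact: loc_integrableS l1|
  exact: loc_integrableS l2|].
move=> phi tphi; have [h1 h2] := h phi (test_functionS VU tphi).
rewrite -!(@Rintegral_zero_off U V)// => x Ux Vx;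
  by have [e0 e1 e2] := pd_test_function tphi Vx; rewrite ?e0 ?e1 ?e2 mulr0.
Qed.

Lemma weak_gradVS U V F G : open U -> V `<=` U -> weak_gradV U F G -> weak_gradV V F G.
Proof. by move=> oU VU [h1 h2]; split; [exact: weak_gradS h1|exact: weak_gradS h2]. Qed.

Lemma W1p_seminorm_ge0 p U F : (0 <= W1p_seminorm p U F)%E.
Proof. by apply/ereal_infP => _ [G _ <-]; exact: Lnorm_ge0. Qed.

Lemma W1p_seminorm_le p U F G : weak_gradV U F G ->
  (W1p_seminorm p U F <= LpN leb2 p%:E U (frobnorm \o G))%E.
Proof. by move=> h; apply: ereal_inf_lbound; exists G. Qed.

Lemma frobnorm_ge0 (M : (R * R) * (R * R)) : 0 <= frobnorm M.
Proof. exact: enorm_ge0. Qed.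

Lemma measurable_enorm U (F : R * R -> R * R) :
  measurable_fun (U : set M2) (fst \o F : M2 -> R) ->
  measurable_fun (U : set M2) (snd \o F : M2 -> R) ->
  measurable_fun (U : set M2) (enorm \o F : M2 -> R).
Proof.
move=> m1 m2; have -> : enorm \o F =
    (fun y : R => y `^ 2^-1) \o (fun x => (fst \o F) x * (fst \o F) x + (snd \o F) x * (snd \o F) x).
  by apply/funext => x /=; rewrite powR12_sqrt ?dotxx_ge0.
apply: (measurableT_comp (measurable_powR _)).
by apply: measurable_funD; exact: measurable_funM.
Qed.

Lemma measurable_frobnorm U (G : R * R -> (R * R) * (R * R)) :
  measurable_fun (U : set M2) (fst \o (fst \o G) : M2 -> R) ->
  measurable_fun (U : set M2) (snd \o (fst \o G) : M2 -> R) ->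
  measurable_fun (U : set M2) (fst \o (snd \o G) : M2 -> R) ->
  measurable_fun (U : set M2) (snd \o (snd \o G) : M2 -> R) ->
  measurable_fun (U : set M2) (frobnorm \o G : M2 -> R).
Proof.
move=> m1 m2 m3 m4.
apply: (@measurable_enorm U (fun x => (enorm (G x).1, enorm (G x).2))).
  exact: (@measurable_enorm U (fst \o G)).
exact: (@measurable_enorm U (snd \o G)).
Qed.

Lemma weak_gradV_measurable U F G : weak_gradV U F G ->
  measurable_fun (U : set M2) (frobnorm \o G : M2 -> R).
Proof. by move=> [[_ [m1 _] [m2 _] _] [_ [m3 _] [m4 _] _]]; exact: measurable_frobnorm. Qed.

Lemma frobnorm_le_sum (M : (R * R) * (R * R)) :
  frobnorm M <= `|M.1.1| + `|M.1.2| + (`|M.2.1| + `|M.2.2|).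
Proof.
apply: (le_trans (enorm_le_sum _)) => /=; rewrite (ger0_norm (enorm_ge0 M.1)) (ger0_norm (enorm_ge0 M.2)).
by apply: lerD; exact: enorm_le_sum.
Qed.

(** The Frobenius norm is at most four times the largest of the four entries. *)
Lemma pint_frobnorm_lty p U G : 0 < p -> measurable (U : set M2) ->
  LpV leb2 p%:E U (fst \o G) -> LpV leb2 p%:E U (snd \o G) ->
  measurable_fun (U : set M2) (frobnorm \o G : M2 -> R) /\
  (pint p U (frobnorm \o G) < +oo)%E.
Proof.
move=> p0 mU [[m1 i1] [m2 i2]] [[m3 i3] [m4 i4]]; split; first exact: measurable_frobnorm.
have {}i1 := LpN_lty p0 i1; have {}i2 := LpN_lty p0 i2.
have {}i3 := LpN_lty p0 i3; have {}i4 := LpN_lty p0 i4.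
pose q (f : R * R -> R) (x : M2) : R := `|f x| `^ p.
pose f1 := fst \o (fst \o G); pose f2' := snd \o (fst \o G).
pose f3 := fst \o (snd \o G); pose f4 := snd \o (snd \o G).
have q0 f x : (0 <= (q f x)%:E)%E by rewrite lee_fin powR_ge0.
have mq f : measurable_fun (U : set M2) (f : M2 -> R) ->
  measurable_fun (U : set M2) (EFin \o q f) by exact: measurable_pow_norm.
apply: (@le_lt_trans _ _ (\int[leb2]_(x in U) ((4 `^ p)%:E *
   (((q f1 x)%:E + (q f2' x)%:E) + ((q f3 x)%:E + (q f4 x)%:E))))%E).
  apply: ge0_le_integral => //.
  - by apply: measurable_pow_norm => //; exact: measurable_frobnorm.
  - apply: emeasurable_funM; first exact: measurable_cst.
    by apply: emeasurable_funD; apply: emeasurable_funD; exact: mq.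
  move=> x _; rewrite -!EFinD -EFinM lee_fin ger0_norm ?frobnorm_ge0//.
  pose m := Num.max (Num.max `|f1 x| `|f2' x|) (Num.max `|f3 x| `|f4 x|).
  have Gm : (frobnorm \o G) x <= 4 * m.
    apply: (le_trans (frobnorm_le_sum _)).
    have : `|f1 x| <= m by rewrite !le_max lexx.
    have : `|f2' x| <= m by rewrite !le_max lexx orbT.
    have : `|f3 x| <= m by rewrite !le_max lexx !orbT.
    have : `|f4 x| <= m by rewrite !le_max lexx !orbT.
    by rewrite /f1 /f2' /f3 /f4 /=; lra.
  have m0 : 0 <= m by rewrite !le_max normr_ge0.
  apply: (@le_trans _ _ ((4 * m) `^ p)).
    by apply: ge0_ler_powR; rewrite ?nnegrE ?frobnorm_ge0 ?mulr_ge0// ltW.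
  rewrite powRM// ler_wpM2l ?powR_ge0//.
  have qq f : 0 <= q f x by exact: powR_ge0.
  have := qq f1; have := qq f2'; have := qq f3; have := qq f4.
  rewrite /m /Num.max; do 3?case: ifP => _; rewrite -/(q _ x); lra.
rewrite ge0_integralZl//; last 2 first.
- by apply: emeasurable_funD; apply: emeasurable_funD; exact: mq.
- by move=> x _; rewrite !adde_ge0.
pose eq f : M2 -> \bar R := EFin \o q f.
have eq0 f x : U x -> (0 <= eq f x)%E by move=> _; exact: q0.
have mD f g : measurable_fun (U : set M2) (f : M2 -> R) ->
    measurable_fun (U : set M2) (g : M2 -> R) ->
    measurable_fun (U : set M2) (fun x => eq f x + eq g x)%E.
  by move=> mf mg; apply: emeasurable_funD; exact: mq.
rewrite (@ge0_integralD _ _ _ leb2 U mU (fun x => eq f1 x + eq f2' x)%E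
  (fun x => eq f3 x + eq f4 x)%E _ (mD _ _ m1 m2) _ (mD _ _ m3 m4)); last 2 first.
- by move=> x _; exact: (adde_ge0 (q0 f1 x) (q0 f2' x)).
- by move=> x _; exact: (adde_ge0 (q0 f3 x) (q0 f4 x)).
rewrite (@ge0_integralD _ _ _ leb2 U mU (eq f1) (eq f2') (eq0 _) (mq _ m1) (eq0 _) (mq _ m2)).
rewrite (@ge0_integralD _ _ _ leb2 U mU (eq f3) (eq f4) (eq0 _) (mq _ m3) (eq0 _) (mq _ m4)).
apply: lte_mul_pinfty; rewrite ?lee_fin ?powR_ge0//.
exact: (lte_add_pinfty (lte_add_pinfty i1 i2) (lte_add_pinfty i3 i4)).
Qed.

End WeakGradients.

(** * Exponents *)

Section Exponents.
Variables (R : realType) (p : R).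
Hypothesis hp : 1 < p < 2.

Definition grading_exp : R := 2 * p / (p + 2).
Definition patch_exp : R := (p + 2) / (2 - p).
Definition rate_exp : R := 1 + 2 / p.
Local Notation mu := grading_exp.
Local Notation gam := patch_exp.
Local Notation nu := rate_exp.

Lemma p_gt1 : 1 < p. Proof. by case/andP: hp. Qed.
Lemma p_lt2 : p < 2. Proof. by case/andP: hp. Qed.
Lemma p_gt0 : 0 < p. Proof. exact: lt_trans ltr01 p_gt1. Qed.

Let p2 : 0 < p + 2. Proof. by rewrite addr_gt0// p_gt0. Qed.
Let q2 : 0 < 2 - p. Proof. by rewrite subr_gt0 p_lt2. Qed.
Let p0 := lt0r_neq0 p_gt0.
Let p20 := lt0r_neq0 p2.
Let q20 := lt0r_neq0 q2.

Lemma mu_gt0 : 0 < mu.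
Proof. by rewrite divr_gt0// mulr_gt0// p_gt0. Qed.

Lemma mu_lt1 : mu < 1.
Proof. by rewrite ltr_pdivrMr// mul1r; have := p_lt2; lra. Qed.

Lemma mu_nu : mu * nu = 2.
Proof. by rewrite /grading_exp /rate_exp; field; rewrite p0 p20. Qed.

Lemma gam_mu : gam * (1 - mu) = 1.
Proof. by rewrite /grading_exp /patch_exp; field; rewrite p20 q20. Qed.

Lemma gam_nu : gam * (2 / p - 1) = nu.
Proof. by rewrite /patch_exp /rate_exp; field; rewrite p0 q20. Qed.

Lemma nu_gt1 : 1 < nu.
Proof. by rewrite ltrDl divr_gt0// p_gt0. Qed.

Lemma nu_lt_gam : nu < gam.
Proof.
have -> : gam = nu + (p + 2) * (2 * (p - 1)) / (p * (2 - p)).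
  by rewrite /patch_exp /rate_exp; field; rewrite p0 q20.
rewrite ltrDl divr_gt0 ?mulr_gt0// ?subr_gt0 ?p_gt1 ?p_gt0//.
Qed.

Lemma gam_gt1 : 1 < gam.
Proof. exact: lt_trans nu_gt1 nu_lt_gam. Qed.

Lemma nu_p : nu * p = p + 2.
Proof. by rewrite /rate_exp; field. Qed.

End Exponents.

Section Simeq.
Variable R : realType.
Implicit Types a b k : R.

Lemma simeqS k k' a b : k <= k' -> 0 <= a -> 0 <= b -> simeq k a b -> simeq k' a b.
Proof.
move=> kk a0 b0 [h1 h2]; split.
  by apply: (le_trans h1); rewrite ler_wpM2r.
by apply: (le_trans h2); rewrite ler_wpM2r.
Qed.

Lemma simeq_gt0 k a b : 0 < k -> 0 < b -> simeq k a b -> 0 < a.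
Proof. by move=> k0 b0 [_ h]; rewrite -(pmulr_rgt0 _ k0) (lt_le_trans b0). Qed.

Lemma ler_powRr (r a b : R) : 0 <= r -> 0 <= a -> a <= b -> a `^ r <= b `^ r.
Proof.
by move=> r0 a0 ab; apply: ge0_ler_powR => //; rewrite nnegrE// (le_trans a0).
Qed.

Lemma lee_poweR (r : R) (x y : \bar R) : 0 <= r -> (0 <= x)%E -> (x <= y)%E ->
  (x `^ r <= y `^ r)%E.
Proof.
move=> r0 x0 xy; apply: gt0_ler_poweR => //; rewrite in_itv /= leey andbT//.
exact: le_trans xy.
Qed.

Lemma powR_exp (r a : R) n : 0 <= a -> (a ^+ n) `^ r = (a `^ r) ^+ n.
Proof.
move=> a0; elim: n => [|n IH]; first by rewrite !expr0 powR1.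
by rewrite exprS powRM ?exprn_ge0// IH -exprS.
Qed.

End Simeq.

(** * Graded meshes *)

Section GradedMesh.
Variables (R : realType) (p : R) (Om : set (R * R)) (x0 : R * R) (K D rho0 : R) (m : nat).
Hypotheses (hp : 1 < p < 2) (oOm : open Om) (x0Om : Om x0).
Hypotheses (K1 : 1 <= K) (D1 : 1 <= D) (rho0_gt0 : 0 < rho0).
Hypothesis closure_le : closure Om `<=` [set x | enorm (x - x0) <= D].
Local Notation M2 := (measurableTypeR R * measurableTypeR R)%type.
Local Notation mu := (grading_exp p).
Local Notation gam := (patch_exp p).
Local Notation nu := (rate_exp p).

(** One mesh of the family. A single constant [K] serves in all its bounds, so
    that the constants below, which only depend on [p], [K], [D], [m], [rho0] and
    the data, are uniform in the family. *)
Record good_mesh (c : R) (T : mesh R) (S : {set 'I_(ncell T)}) : Prop := GoodMesh {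
  good_gt0 : 0 < c;
  good_tri : triangulation T Om;
  good_reg : shape_regular T K;
  good_center : forall k, elem k x0 -> k \in S;
  good_card : (#|S| <= m)%N;
  good_dist : hpatch S <= K * distpt x0 (bdry (patch_set S));
  good_graded : graded S p rho0 c x0 K }.

Let K0 : 0 < K. Proof. exact: lt_le_trans ltr01 K1. Qed.
Let D0 : 0 < D. Proof. exact: lt_le_trans ltr01 D1. Qed.
Let K0W := ltW K0.
Let D0W := ltW D0.
Let mu0 := mu_gt0 hp.
Let mu1 := mu_lt1 hp.

Lemma distpt_ge0 (x : R * R) (E : set (R * R)) : 0 <= distpt x E.
Proof.
rewrite /distpt; set S := [set _ | _ in _].
have [S0|/set0P/negP/negPn/eqP->] := pselect (S !=set0); last by rewrite inf0.
by apply: lb_le_inf => // _ [y _ <-]; exact: enorm_ge0.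
Qed.

Lemma hpatch_ge0 (T : mesh R) (S : {set 'I_(ncell T)}) : 0 <= hpatch S.
Proof. exact: bigmax_ge_id. Qed.

Lemma good_mesh_of (kr kp kg c : R) (T : mesh R) (S : {set 'I_(ncell T)}) :
  kr <= K -> kp <= K -> kg <= K -> 0 < c -> triangulation T Om ->
  shape_regular T kr -> is_patch S x0 m kp -> graded S p rho0 c x0 kg ->
  good_mesh c S.
Proof.
move=> krK kpK kgK c0 tri reg [x0S _ Sm _ [_ dS]] [hin hout hp0].
have hk0 (k : 'I_(ncell T)) : 0 <= hK k.
  apply: (le_trans (enorm_ge0 (bary k - bary k))).
  by apply: (le_hK tri closure_le); exact: (bary_in tri).
split=> //.
- move=> k; have [y [r [r0 yr hr]]] := reg k; exists y, r; split=> //.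
  by apply: (le_trans hr); rewrite ler_pM2r.
- by apply: (le_trans dS); rewrite ler_wpM2r ?distpt_ge0.
- split.
  + move=> k kB; apply: simeqS kgK (hk0 k) _ (hin k kB).
    by rewrite mulr_ge0 ?powR_ge0 ?(ltW c0).
  + by move=> k kB; exact: simeqS kgK (hk0 k) (ltW c0) (hout k kB).
  + exact: simeqS kgK (hpatch_ge0 S) (powR_ge0 _ _) hp0.
Qed.

Section OneMesh.
Variables (c : R) (T : mesh R) (S : {set 'I_(ncell T)}).
Hypothesis good : good_mesh c S.
Implicit Types (k : 'I_(ncell T)) (x : R * R).
Local Notation h0 := (hpatch S).
Local Notation dbary k := (enorm (bary k - x0)).

Let c0 : 0 < c. Proof. exact: good_gt0 good. Qed.
Let c0W := ltW c0.
Let tri : triangulation T Om. Proof. exact: good_tri good. Qed.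

Lemma hpatch_simeq : simeq K h0 (c `^ gam).
Proof. by case: (good_graded good). Qed.

Lemma hpatch_gt0 : 0 < h0.
Proof. by apply: (simeq_gt0 K0 _ hpatch_simeq); exact: powR_gt0. Qed.

(** The size of the patch, of order [c ^ gam], is bounded by the size of the
    domain. *)
Lemma mesh_param_le : c <= 2 * K * D.
Proof.
have [c1|c1] := leP c 1.
  by have := mulr_ege1 K1 D1; lra.
apply: (@le_trans _ _ (c `^ gam)).
  by apply: le1r_powR; [exact: ltW|exact/ltW/(gam_gt1 hp)].
apply: (le_trans hpatch_simeq.2); rewrite mulrAC [leLHS]mulrC ler_pM2r//.
by apply: (hpatch_le tri closure_le) => //; exact: ltW.
Qed.

Lemma outside_far k x : k \notin S -> (elem k)° x -> h0 <= K * enorm (x - x0).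
Proof.
move=> kS kx; apply: (le_trans (good_dist good)); rewrite ler_pM2l//.
exact: (elem_outside_dist tri oOm x0Om (good_center good) kS kx).
Qed.

Lemma bary_far k : k \notin S -> h0 <= K * dbary k.
Proof. by move=> kS; apply: (outside_far kS); apply: bary_elem; exact: (mesh_nondegenerate tri). Qed.

Lemma dbary_gt0 k : k \notin S -> 0 < dbary k.
Proof. by move=> kS; rewrite -(pmulr_rgt0 _ K0) (lt_le_trans hpatch_gt0)// bary_far. Qed.

Lemma max_bary_gt0 k : 0 < Num.max (dbary k) h0.
Proof. by rewrite lt_max hpatch_gt0 orbT. Qed.

Lemma hK_gt0 k : 0 < hK k.
Proof.
have [hin hout _] := good_graded good.
have [kB|kB] := pselect (elem k `<=` eball x0 rho0).
  by apply: (simeq_gt0 K0 _ (hin k kB)); rewrite mulr_gt0// powR_gt0// max_bary_gt0.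
exact: (simeq_gt0 K0 c0 (hout k kB)).
Qed.

Lemma hK_le_param k : hK k <= 2 * K * D * c.
Proof.
have [hin hout _] := good_graded good.
have [kB|kB] := pselect (elem k `<=` eball x0 rho0).
  apply: (le_trans (hin k kB).1).
  have -> : 2 * K * D * c = K * (c * (2 * D)) by ring.
  rewrite !ler_pM2l//; apply: (@le_trans _ _ ((2 * D) `^ mu)).
    apply: ler_powRr; [exact: ltW|exact/ltW/max_bary_gt0|].
    rewrite ge_max (hpatch_le tri closure_le) ?andbT//.
    by have := elem_dist tri closure_le (bary_in tri k); have := D0; lra.
  by apply: ler1_powR; [have := D1; lra|exact: ltW].
apply: (le_trans (hout k kB).1); rewrite ler_pM2r//.
by rewrite mulrAC ler_peMl//; have := D1; lra.
Qed.

(** Outside the patch the maximum in the grading condition is, up to a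
    constant, the distance of the barycenter. *)
Lemma hK_graded k : k \notin S -> elem k `<=` eball x0 rho0 ->
  c * dbary k `^ mu <= K * hK k /\ hK k <= K ^+ 2 * (c * dbary k `^ mu).
Proof.
move=> kS kB; have [/(_ k kB) [h1 h2] _ _] := good_graded good.
have a0 := dbary_gt0 kS; have a0W := ltW a0; split.
  apply: le_trans h2; rewrite ler_pM2l//; apply: ler_powRr; [exact: ltW..|].
  by rewrite le_max lexx.
apply: (le_trans h1).
have -> : K ^+ 2 * (c * dbary k `^ mu) = K * (c * (K * dbary k `^ mu)) by ring.
rewrite !ler_pM2l//.
apply: (@le_trans _ _ ((K * dbary k) `^ mu)).
  apply: ler_powRr; [exact: ltW|exact/ltW/max_bary_gt0|].
  by rewrite ge_max bary_far// andbT ler_peMl// ltW.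
rewrite powRM // ler_wpM2r ?powR_ge0//.
by apply: ler1_powR => //; exact: ltW.
Qed.

Lemma powR_gam_mu (t : R) : 0 <= t -> (t `^ gam) `^ (1 - mu) = t.
Proof. by move=> t0; rewrite -powRrM gam_mu// powRr1. Qed.

Lemma powR_mu_gam (t : R) : 0 <= t -> (t `^ (1 - mu)) `^ gam = t.
Proof. by move=> t0; rewrite -powRrM mulrC gam_mu// powRr1. Qed.

Lemma powR_mu_split (t : R) : 0 < t -> t `^ (1 - mu) * t `^ mu = t.
Proof.
by move=> t0; have tW := ltW t0; rewrite -powRD ?subrK ?powRr1// oner_eq0.
Qed.

Definition dist_const : R := 2 + K ^+ 4 + (2 * K ^+ 2) `^ gam * K ^+ 2.

Lemma dist_const_ge1 : 1 <= dist_const.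
Proof.
have : 0 <= K ^+ 4 by rewrite exprn_ge0// ltW.
have : 0 <= (2 * K ^+ 2) `^ gam * K ^+ 2 by rewrite mulr_ge0 ?powR_ge0// exprn_ge0// ltW.
by rewrite /dist_const; lra.
Qed.

(** An element has no more than the size of its distance to [x0], so its
    points are at comparable distances from [x0]. If its diameter exceeds half
    the distance of the barycenter, the grading forces that distance to be of
    the size of the patch. *)
Lemma dist_bary k x : k \notin S -> elem k `<=` eball x0 rho0 -> (elem k)° x ->
  enorm (x - x0) <= dist_const * dbary k /\ dbary k <= dist_const * enorm (x - x0).
Proof.
move=> kS kB kx; have a0 := dbary_gt0 kS; have a0W := ltW a0; have [_ hup] := hK_graded kS kB.
have tb := le_hK tri closure_le (interior_elem_sub kx) (bary_in tri k).
have hx := outside_far kS kx.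
have K40 : 0 <= K ^+ 4 by rewrite exprn_ge0// ltW.
have X0 : 0 <= (2 * K ^+ 2) `^ gam * K ^+ 2 by rewrite mulr_ge0 ?powR_ge0// exprn_ge0// ltW.
have K20 : 0 < K ^+ 2 by rewrite exprn_gt0.
have K20W := ltW K20.
have K21 : 1 <= K ^+ 2 by rewrite exprn_ege1.
have m10 : 0 <= 1 - mu by rewrite subr_ge0 ltW.
have t0 := enorm_ge0 (x - x0); split.
  have ca : c <= K ^+ 2 * dbary k `^ (1 - mu).
    rewrite -(powR_gam_mu (ltW c0)); apply: (@le_trans _ _ ((K ^+ 2 * dbary k) `^ (1 - mu))).
      apply: ler_powRr => //; first exact: powR_ge0.
      by apply: (le_trans hpatch_simeq.2); rewrite expr2 -mulrA ler_pM2l// bary_far.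
    rewrite powRM // ler_wpM2r ?powR_ge0//.
    by apply: ler1_powR => //; have := mu0; lra.
  have ha : hK k <= K ^+ 4 * dbary k.
    apply: (le_trans hup).
    have -> : K ^+ 4 * dbary k = K ^+ 2 * (K ^+ 2 * dbary k `^ (1 - mu) * dbary k `^ mu).
      by rewrite -[in LHS](powR_mu_split a0); ring.
    by rewrite ler_pM2l// ler_wpM2r// powR_ge0.
  apply: (le_trans (ler_enorm_dist (bary k) _ _)).
  apply: (@le_trans _ _ ((2 + K ^+ 4) * dbary k)); first by lra.
  by rewrite ler_wpM2r // /dist_const lerDl.
have [at2|ta] := leP (dbary k) (2 * enorm (x - x0)).
  by apply: (le_trans at2); rewrite ler_wpM2r// /dist_const -addrA lerDl addr_ge0.
have a2h : dbary k <= 2 * hK k.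
  by have := ler_enorm_dist x (bary k) x0; rewrite (enorm_distC (bary k) x); lra.
have ac : dbary k `^ (1 - mu) <= 2 * K ^+ 2 * c.
  rewrite -(ler_pM2r (powR_gt0 mu a0)) (powR_mu_split a0).
  apply: (le_trans a2h).
  have -> : 2 * K ^+ 2 * c * dbary k `^ mu = 2 * (K ^+ 2 * (c * dbary k `^ mu)) by ring.
  by rewrite ler_pM2l.
have : dbary k <= (2 * K ^+ 2) `^ gam * K ^+ 2 * enorm (x - x0).
  rewrite -{1}(powR_mu_gam (ltW a0)).
  apply: (@le_trans _ _ ((2 * K ^+ 2 * c) `^ gam)).
    by apply: ler_powRr => //; [have := gam_gt1 hp; lra|exact: powR_ge0].
  rewrite powRM ?mulr_ge0// -mulrA ler_wpM2l ?powR_ge0//.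
  by apply: (le_trans hpatch_simeq.2); rewrite expr2 -mulrA ler_pM2l.
move/le_trans; apply; rewrite ler_wpM2r// /dist_const lerDr.
by rewrite addr_ge0.
Qed.

(** The exponent of the grading is chosen so that the powers of the distance
    cancel: [mu * (1 + 2 / p) = 2]. *)
Lemma elem_bound_simeq (Csig : R) k : 0 < Csig -> k \notin S ->
  elem k `<=` eball x0 rho0 ->
  elem_bound p x0 Csig k <= Csig * (K ^+ 2) `^ nu * c `^ nu /\
  c `^ nu <= K `^ nu / Csig * elem_bound p x0 Csig k.
Proof.
move=> Cs0 kS kB; have a0 := dbary_gt0 kS; have a0W := ltW a0; have [hlow hup] := hK_graded kS kB.
have hk0 := hK_gt0 k; have hk0W := ltW hk0.
have nu0 : 0 <= nu by have := nu_gt1 hp; lra.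
have ebE : elem_bound p x0 Csig k = Csig * (dbary k ^+ 2)^-1 * hK k `^ nu.
  rewrite /elem_bound powR_invn //.
  have -> : hK k `^ nu = hK k * hK k `^ (2 / p).
    by rewrite /rate_exp powRD ?powRr1//; apply/implyP => _; exact: lt0r_neq0.
  by rewrite mulrCA -!mulrA.
have canu : (c * dbary k `^ mu) `^ nu = c `^ nu * dbary k ^+ 2.
  by rewrite powRM ?powR_ge0// -powRrM mu_nu// powR_mulrn.
have a20 : 0 < dbary k ^+ 2 by rewrite exprn_gt0.
rewrite ebE; split.
  rewrite -!mulrA ler_pM2l// mulrC ler_pdivrMr// -mulrA -canu -powRM ?exprn_ge0 ?mulr_ge0 ?powR_ge0//.
  by apply: ler_powRr => //; exact: ltW.
have -> : K `^ nu / Csig * (Csig / dbary k ^+ 2 * hK k `^ nu) =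
  K `^ nu * hK k `^ nu / dbary k ^+ 2.
  field; apply/andP; split; exact: lt0r_neq0.
rewrite ler_pdivlMr// -canu -powRM ?mulr_ge0 ?powR_ge0//; apply: ler_powRr => //.
by rewrite mulr_ge0 ?powR_ge0.
Qed.

End OneMesh.

(** * The number of elements *)

(** Elements away from [x0] all have diameter of order [c] and area of order
    [c ^+ 2]. *)
Lemma count_outer c (T : mesh R) (S : {set 'I_(ncell T)}) : good_mesh c S ->
  #|[set k : 'I_(ncell T) | ~~ `[< elem k `<=` eball x0 rho0 >]]%SET|%:R * c ^+ 2
    <= 16 * D ^+ 2 * K ^+ 4.
Proof.
move=> good; have tri := good_tri good.
have D2 : 0 < 2 * D by rewrite mulr_gt0.
have mB : measurable (eball x0 (2 * D) : set M2).
  by apply: open_measurable2; exact: eball_open.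
have lB : (leb2 (eball x0 (2 * D)) <= (16 * D ^+ 2)%:E)%E.
  have -> : 16 * D ^+ 2 = 4 * (2 * D) ^+ 2 by ring.
  by apply: (leb2_le_square (x := x0)).
rewrite -ler_pdivrMr ?exprn_gt0// -mulrA.
apply: (packing tri mB lB) => k.
  move=> _ x /interior_elem_sub kx; rewrite /eball /=.
  by have := elem_dist tri closure_le kx; lra.
rewrite inE => /asboolPn kB; have hk0 := hK_gt0 good k.
apply: le_trans (leb2_elem_ge K0 (ltW hk0) (good_reg good)).
have [_ hk] : simeq K (hK k) c by have [_ hout _] := good_graded good; exact: hout.
have -> : c ^+ 2 / K ^+ 4 = (c / K / K) ^+ 2 by field; exact: lt0r_neq0.
have c0 := good_gt0 good.
rewrite lee_fin lerXn2r ?nnegrE ?divr_ge0// ?(ltW c0) ?(ltW hk0)//.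
by rewrite ler_pM2r ?invr_gt0// ler_pdivrMr// mulrC.
Qed.

Definition shell_const : R := 64 * dist_const ^+ 2 * D ^+ 2 * K ^+ 4.
Definition shell_ratio : R := 4^-1 `^ (1 - mu).

Lemma shell_const_gt0 : 0 < shell_const.
Proof.
have d1 : 0 < dist_const by exact: lt_le_trans dist_const_ge1.
by rewrite !mulr_gt0// exprn_gt0.
Qed.

Lemma shell_ratio_ge0 : 0 <= shell_ratio.
Proof. exact: powR_ge0. Qed.

Lemma shell_ratio_lt1 : shell_ratio < 1.
Proof.
have e1 : (1 : R) `^ (1 - mu) = 1 by rewrite powR1.
rewrite -[ltRHS]e1; apply: gt0_ltr_powR; rewrite ?nnegrE ?subr_gt0//.
by rewrite invf_lt1// ltr1n.
Qed.

(** Near [x0], the elements at distance of order [s] have area at least of order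
    [c ^+ 2 * s ^ (2 * mu)], and they lie in a disk of area of order [s ^+ 2]. *)
Lemma count_shell c (T : mesh R) (S : {set 'I_(ncell T)}) (I : {set 'I_(ncell T)}) (s : R) :
  good_mesh c S -> 0 < s ->
  (forall k, k \in I -> [/\ k \notin S, elem k `<=` eball x0 rho0,
     D * (s / 2) < enorm (bary k - x0) & enorm (bary k - x0) <= D * s]) ->
  #|I|%:R * c ^+ 2 <= shell_const * (s ^+ 2) `^ (1 - mu).
Proof.
move=> good s0 HI; have tri := good_tri good; have c0 := good_gt0 good.
have c0W := ltW c0; have s0W := ltW s0.
have d1 := dist_const_ge1; have d0 : 0 < dist_const by exact: lt_le_trans d1.
have r0 : 0 < 2 * (dist_const * (D * s)) by rewrite !mulr_gt0.
have mB : measurable (eball x0 (2 * (dist_const * (D * s))) : set M2).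
  by apply: open_measurable2; exact: eball_open.
have lB := leb2_le_square mB r0 (fun y => id : eball x0 _ y -> _).
have s2 : 0 < s / 2 by rewrite divr_gt0.
have e1 : (s / 2) ^+ 2 = 4^-1 * s ^+ 2 by field.
pose a : R := c ^+ 2 * ((s / 2) ^+ 2) `^ mu / K ^+ 4.
have h : #|I|%:R * a <= 4 * (2 * (dist_const * (D * s))) ^+ 2.
  apply: (packing tri mB lB) => k /HI [kS kB ka kb].
    move=> x kx; rewrite /eball /=; have [xa _] := dist_bary good kS kB kx.
    apply: (le_lt_trans xa); apply: (@le_lt_trans _ _ (dist_const * (D * s))).
      by rewrite ler_pM2l.
    by have := r0; lra.
  have hk0 := hK_gt0 good k.
  apply: le_trans (leb2_elem_ge K0 (ltW hk0) (good_reg good)).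
  have -> : a = (c * (s / 2) `^ mu / K / K) ^+ 2.
    rewrite /a powR_exp; last exact: ltW.
    by field; exact: lt0r_neq0.
  have [hl _] := hK_graded good kS kB.
  have p0 : 0 <= c * (s / 2) `^ mu by rewrite mulr_ge0 ?powR_ge0.
  rewrite lee_fin lerXn2r ?nnegrE ?divr_ge0// ?(ltW hk0)//.
  rewrite ler_pM2r ?invr_gt0// ler_pdivrMr// [leRHS]mulrC; apply: le_trans hl.
  rewrite ler_pM2l//; apply: ler_powRr; [exact: ltW|exact: ltW|].
  apply: le_trans (ltW ka); rewrite ler_peMl// ltW//.
have K4 : 0 < K ^+ 4 by rewrite exprn_gt0.
have sp : 0 < s ^+ 2 by rewrite exprn_gt0.
have spW := ltW sp.
have smu : 0 < (s ^+ 2) `^ mu by rewrite powR_gt0.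
rewrite -(ler_pM2r smu).
have -> : shell_const * (s ^+ 2) `^ (1 - mu) * (s ^+ 2) `^ mu =
  4 * (4 * (2 * (dist_const * (D * s))) ^+ 2 * K ^+ 4).
  rewrite -mulrA -powRD ?subrK ?powRr1 ?oner_eq0// /shell_const; ring.
apply: (@le_trans _ _ (4 * (#|I|%:R * a * K ^+ 4))); last first.
  by rewrite ler_pM2l// ler_pM2r.
have -> : #|I|%:R * a * K ^+ 4 = #|I|%:R * c ^+ 2 * ((s / 2) ^+ 2) `^ mu.
  by rewrite /a; field; exact: lt0r_neq0.
rewrite [leRHS](mulrCA 4 (_ * _)) ler_wpM2l ?mulr_ge0 ?exprn_ge0//.
rewrite e1 (@powRM _ 4^-1 (s ^+ 2))// [leRHS]mulrA ler_peMl//; first exact: ltW.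
have q4 : (4^-1 : R) <= 4^-1 `^ mu.
  by apply: ger1_powR; [apply/andP; split; lra|exact: ltW].
by have := q4; lra.
Qed.

(** Summing over dyadic shells gives a geometric series, because [mu < 1]. The
    shells exhaust the elements, since all of them are farther from [x0] than a
    multiple of the size of the patch. *)
Lemma count_inner c (T : mesh R) (S : {set 'I_(ncell T)}) : good_mesh c S ->
  #|[set k | (k \notin S) && `[< elem k `<=` eball x0 rho0 >]]%SET|%:R * c ^+ 2
    <= shell_const / (1 - shell_ratio).
Proof.
move=> good; have tri := good_tri good.
pose I (M : nat) := [set k | [&& k \notin S, `[< elem k `<=` eball x0 rho0 >]
  & D * 2^-1 ^+ M < enorm (bary k - x0)]]%SET.
have q0 := shell_ratio_ge0; have q1 := shell_ratio_lt1.
have q10 : 0 < 1 - shell_ratio by rewrite subr_gt0.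
have IM M : #|I M|%:R * c ^+ 2 <= shell_const * (1 - shell_ratio ^+ M) / (1 - shell_ratio).
  elim: M => [|M IH].
    rewrite expr0 subrr mulr0 mul0r (_ : I 0%N = finset.set0) ?cards0 ?mul0r//.
    apply/setP => k; rewrite !inE expr0 mulr1; apply/negP => /and3P[_ _].
    by rewrite ltNge (elem_dist tri closure_le (bary_in tri k)).
  have s0 : 0 < (2^-1 : R) ^+ M by rewrite exprn_gt0.
  have := @count_shell c T S (I M.+1 :\: I M) _ good s0; move=> h.
  have {}h : #|I M.+1 :\: I M|%:R * c ^+ 2 <= shell_const * shell_ratio ^+ M.
    have -> : shell_ratio ^+ M = ((2^-1 ^+ M) ^+ 2) `^ (1 - mu).
      rewrite /shell_ratio -exprM mulnC exprM (_ : 2^-1 ^+ 2 = 4^-1 :> R); last by field.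
      by rewrite powR_exp.
    apply: h => k; rewrite !inE => /andP[+ /and3P[kS kB ka]].
    rewrite kS kB /= -leNgt => kb; split=> //; first exact/asboolP.
    by move: ka; rewrite exprSr.
  have card : (#|I M.+1| <= #|I M| + #|I M.+1 :\: I M|)%N.
    by rewrite -(cardsID (I M) (I M.+1)) leq_add2r subset_leq_card// finset.subsetIr.
  have c2 : 0 <= c ^+ 2 by rewrite sqr_ge0.
  apply: (@le_trans _ _ ((#|I M| + #|I M.+1 :\: I M|)%:R * c ^+ 2)).
    by rewrite ler_wpM2r// ler_nat.
  rewrite natrD mulrDl; apply: (le_trans (lerD IH h)).
  rewrite le_eqVlt; apply/orP; left; apply/eqP.
  by rewrite exprS; field; exact: lt0r_neq0.
have h00 := hpatch_gt0 good.
pose e := hpatch S / K / D.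
have e0 : 0 < e by rewrite !divr_gt0.
have [M Me] : exists M : nat, (2^-1 : R) ^+ M < e.
  exists (Num.bound e^-1); rewrite exprVn -[ltRHS]invrK ltf_pV2 ?posrE ?exprn_gt0 ?invr_gt0//.
  apply: (lt_trans (archi_boundP _)); first by rewrite invr_ge0 ltW.
  by rewrite -natrX ltr_nat ltn_expl.
have -> : [set k | (k \notin S) && `[< elem k `<=` eball x0 rho0 >]]%SET = I M.
  apply/setP => k; rewrite !inE; have [kS|//] := boolP (k \notin S).
  case: `[< _ >] => //=; apply/esym; rewrite -ltr_pdivlMl// mulrC.
  apply: (lt_le_trans Me); rewrite ler_pM2r ?invr_gt0// ler_pdivrMr// mulrC.
  exact: (bary_far good kS).
apply: (le_trans (IM M)); rewrite ler_pM2r ?invr_gt0// ler_piMr ?(ltW shell_const_gt0)//.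
by rewrite lerBlDr lerDl exprn_ge0.
Qed.

(** The patch has at most [m] elements, and [m] is at most of order
    [c ^ (-2)] because [c] is bounded. *)
Lemma ncell_le : exists2 C, 0 < C & forall c (T : mesh R) (S : {set 'I_(ncell T)}),
  good_mesh c S -> (ncell T)%:R <= C * c `^ (- 2).
Proof.
pose C := m%:R * (2 * K * D) ^+ 2 + shell_const / (1 - shell_ratio) + 16 * D ^+ 2 * K ^+ 4.
have q10 : 0 < 1 - shell_ratio by rewrite subr_gt0 shell_ratio_lt1.
exists C.
  apply: ltr_wpDl; last by rewrite !mulr_gt0// exprn_gt0.
  apply: addr_ge0; first by rewrite mulr_ge0 ?sqr_ge0.
  by rewrite ltW// divr_gt0// shell_const_gt0.
move=> c T S good; have c0 := good_gt0 good.
rewrite powR_invn ?(ltW c0)// ler_pdivlMr ?exprn_gt0//.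
have h1 := count_outer good; have h2 := count_inner good.
have h3 : #|S|%:R * c ^+ 2 <= m%:R * (2 * K * D) ^+ 2.
  have Sm := good_card good.
  rewrite ler_pM// ?sqr_ge0// ?ler_nat// lerXn2r ?nnegrE ?(ltW c0)//.
    by rewrite !mulr_ge0// ltW.
  exact: mesh_param_le good.
set I1 := [set k | _]%SET in h1; set I2 := [set k | _]%SET in h2.
have card : (ncell T <= #|S| + #|I2| + #|I1|)%N.
  rewrite -[leqLHS]card_ord -cardsT.
  have -> : [set: 'I_(ncell T)]%SET = S :|: I2 :|: I1.
    by apply/setP => k; rewrite !inE; case: (k \in S) => //=; case: `[< _ >].
  apply: (leq_trans (leq_card_setU _ _)); rewrite leq_add2r; exact: leq_card_setU.
have c2 : 0 <= c ^+ 2 by rewrite sqr_ge0.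
apply: (@le_trans _ _ ((#|S| + #|I2| + #|I1|)%:R * c ^+ 2)).
  by rewrite ler_wpM2r// ler_nat.
by rewrite !natrD !mulrDl !lerD.
Qed.

(** All diameters are at most of order [c], and the elements cover [Om]. *)
Lemma ncell_ge : exists2 C, 0 < C & forall c (T : mesh R) (S : {set 'I_(ncell T)}),
  good_mesh c S -> c `^ (- 2) <= C * (ncell T)%:R.
Proof.
have [r r0 rOm] := (nbhs_eball x0 Om).1 (open_nbhs_nbhs (conj oOm x0Om)).
have KD : 0 < 2 * K * D by rewrite !mulr_gt0.
exists (16 * (2 * K * D) ^+ 2 / r ^+ 2); first by rewrite divr_gt0 ?mulr_gt0 ?exprn_gt0.
move=> c T S good; have c0 := good_gt0 good.
have h0 : 0 < 2 * K * D * c by rewrite mulr_gt0.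
have := covering (good_tri good) closure_le h0 oOm (hK_le_param good).
have := leb2_ge_square (open_measurable2 oOm) r0 rOm.
move=> /le_trans /[apply]; rewrite lee_fin => h.
rewrite powR_invn ?(ltW c0)// -[leLHS]div1r ler_pdivrMr ?exprn_gt0//.
rewrite -(ler_pM2r (exprn_gt0 2 r0)) mul1r (le_trans h)// le_eqVlt.
by apply/orP; left; apply/eqP; field; exact: lt0r_neq0.
Qed.

(** * Elementwise terms *)

Section Estimates.
Variables (J : nat) (P : 'I_J -> set (R * R)) (sig : R * R -> R * R).
Variables (G : R * R -> (R * R) * (R * R)) (Csig : R).
Hypotheses (partP : partition_of P Om) (hG : broken_grad P x0 sig G) (Csig_gt0 : 0 < Csig).
Hypothesis G_pointwise : {ae leb2, forall x, (Om `&` eball x0 rho0) x -> x <> x0 ->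
     frobnorm (G x) <= Csig * enorm (x - x0) `^ (- 2)}.
Hypothesis G_far : LpV leb2 p%:E (Om `\` closure (eball x0 rho0)) (fst \o G) /\
         LpV leb2 p%:E (Om `\` closure (eball x0 rho0)) (snd \o G).
Local Notation gn := (frobnorm \o G).
Local Notation far := (closure (eball x0 rho0)).

Let p0 : 0 < p := p_gt0 hp.
Let p1 : 1 < p := p_gt1 hp.
Let p0W := ltW p0.
Let CsigW := ltW Csig_gt0.
Let dcW : 0 <= dist_const. Proof. exact: le_trans ler01 dist_const_ge1. Qed.
Let pn0 : p != 0. Proof. exact: lt0r_neq0. Qed.

Lemma measurable_far : measurable (far : set M2).
Proof. by apply: closed_measurable2; exact: closed_closure. Qed.

Section OneElement.
Variables (c : R) (T : mesh R) (S : {set 'I_(ncell T)}).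
Hypotheses (good : good_mesh c S) (fitT : fitted T P).
Implicit Types (k : 'I_(ncell T)) (x : R * R).

Lemma elem_in_part k : exists j, (elem k)° `<=` P j.
Proof.
have [j kj] := fitT k; exists j; case: partP => LP _ _ _.
by apply: subset_trans (lipschitz_interior_closure (LP j)); exact: interiorS.
Qed.

Lemma elem_in_domain k : (elem k)° `<=` Om.
Proof. by have [j kj] := elem_in_part k; case: partP => _ PO _ _; exact: subset_trans (PO j). Qed.

Lemma elem_neq_center k x : k \notin S -> (elem k)° x -> x <> x0.
Proof.
move=> kS kx xx0; have := outside_far good kS kx; rewrite leNgt => /negP; apply.
by rewrite xx0 subrr /enorm /dot /= mul0r addr0 sqrtr0 mulr0 (hpatch_gt0 good).
Qed.

(** The broken gradient is a weak gradient on each element outside the patch,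
    since the mesh is fitted to the partition and such an element misses [x0]. *)
Lemma elem_weak_grad k : k \notin S -> weak_gradV (elem k)° sig G.
Proof.
move=> kS; have [j kj] := elem_in_part k; case: partP => LP _ _ _.
have oP : open (P j `\ x0).
  apply: openI; first by case: (LP j) => [[]].
  by apply: closed_openC; apply: accessible_closed_set1; apply: hausdorff_accessible; exact: norm_hausdorff.
apply: weak_gradVS oP _ (hG j) => x kx; split; first exact: kj.
exact: elem_neq_center kS kx.
Qed.

Lemma measurable_gn_elem k : k \notin S ->
  measurable_fun ((elem k)° : set M2) (gn : M2 -> R).
Proof. by move=> kS; exact: weak_gradV_measurable (elem_weak_grad kS). Qed.

Lemma seminorm_le_pint k : k \notin S ->
  (W1p_seminorm p (elem k)° sig `^ p <= pint p (elem k)° gn)%E.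
Proof.
move=> kS; rewrite -(LpN_poweR p0); apply: lee_poweR => //; first exact: W1p_seminorm_ge0.
exact: W1p_seminorm_le (elem_weak_grad kS).
Qed.

(** The pointwise bound is of order [Csig * dbary ^ (-2)] on the whole element,
    whose area is of order [hK ^ 2]. *)
Lemma elem_pint_inner k : k \notin S -> elem k `<=` eball x0 rho0 ->
  ((hK k `^ p)%:E * pint p (elem k)° gn <=
   ((16 * dist_const ^+ 2 * elem_bound p x0 Csig k) `^ p)%:E)%E.
Proof.
move=> kS kB; have a0 := dbary_gt0 good kS; have h0 := hK_gt0 good k.
have d1 := dist_const_ge1; have d0 : 0 < dist_const by exact: lt_le_trans d1.
set a := enorm (bary k - x0) in a0 *.
pose B : R := Csig * (dist_const ^+ 2 * (a ^+ 2)^-1).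
have B0 : 0 < B by rewrite !mulr_gt0// ?invr_gt0 exprn_gt0.
have [a0W h0W d0W B0W] := And4 (ltW a0) (ltW h0) (ltW d0) (ltW B0).
have mk := measurable_elem_interior (T := T) k.
have hB : (pint p (elem k)° gn <= (B `^ p)%:E * leb2 (elem k)°)%E.
  apply: pint_le_cst => //; first exact: measurable_gn_elem.
  apply: ae_leb2S G_pointwise => x Gx kx; rewrite ger0_norm ?frobnorm_ge0//.
  have xx0 := elem_neq_center kS kx.
  apply: (le_trans (Gx _ xx0)).
    by split; [exact: elem_in_domain kx|exact/kB/interior_elem_sub].
  have [_ xa] := dist_bary good kS kB kx.
  have t0 : 0 < enorm (x - x0) by apply: enorm_gt0; rewrite subr_eq0; apply/eqP.
  rewrite powR_invn ?(ltW t0)// ler_pM2l// ler_pdivlMr ?exprn_gt0// mulrC.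
  rewrite ler_pdivrMr ?exprn_gt0// -exprMn lerXn2r ?nnegrE ?mulr_ge0// ltW//.
apply: (@le_trans _ _ ((hK k `^ p)%:E * ((B `^ p)%:E * (16 * hK k ^+ 2)%:E))%E).
  apply: lee_wpmul2l; first by rewrite lee_fin powR_ge0.
  apply: (le_trans hB); apply: lee_wpmul2l; first by rewrite lee_fin powR_ge0.
  exact: (leb2_elem_le (good_tri good) closure_le h0).
have ebE : 16 * dist_const ^+ 2 * elem_bound p x0 Csig k =
    16 * (hK k * (B * hK k `^ (2 / p))).
  by rewrite /elem_bound -/a powR_invn// /B; ring.
rewrite ebE; clearbody B.
rewrite -!EFinM lee_fin powRM ?mulr_ge0 ?powR_ge0//.
rewrite (powRM _ h0W) ?mulr_ge0 ?powR_ge0// (powRM _ B0W) ?powR_ge0//.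
have -> : (hK k `^ (2 / p)) `^ p = hK k ^+ 2.
  by rewrite -powRrM divfK// powR_mulrn.
have -> : hK k `^ p * (B `^ p * (16 * hK k ^+ 2)) =
  16 * (hK k `^ p * (B `^ p * hK k ^+ 2)) by ring.
rewrite ler_wpM2r ?mulr_ge0 ?powR_ge0 ?exprn_ge0//.
by apply: le1r_powR; [rewrite ler1n|exact: ltW].
Qed.

Definition center_dist : R := Num.min (rho0 / 2) ((rho0 / (2 * K)) `^ gam / K ^+ 2).

Lemma center_dist_gt0 : 0 < center_dist.
Proof.
rewrite lt_min divr_gt0//= divr_gt0 ?exprn_gt0// powR_gt0// divr_gt0// mulr_gt0//.
Qed.

(** An element that reaches out of the disk stays away from [x0]: it is small
    if [c] is small, and otherwise the patch is large. *)
Lemma outer_elem_far k x : k \notin S -> ~ elem k `<=` eball x0 rho0 ->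
  (elem k)° x -> center_dist <= enorm (x - x0).
Proof.
move=> kS kB kx; have c0 := good_gt0 good.
have [c1|c1] := leP c (rho0 / (2 * K)).
  move/existsNP: kB => [y /not_implyP[ky /negP]]; rewrite -leNgt => yr.
  have [hk _] : simeq K (hK k) c.
    have [_ hout _] := good_graded good; apply: hout => /(_ y ky).
    by rewrite /eball /= ltNge yr.
  have := le_hK (good_tri good) closure_le ky (interior_elem_sub kx).
  have := ler_enorm_dist x y x0.
  have : K * c <= rho0 / 2.
    by rewrite mulrC -ler_pdivlMr// -mulrA -invfM.
  by rewrite ge_min; move=> *; apply/orP; left; lra.
rewrite ge_min; apply/orP; right; rewrite ler_pdivrMr ?exprn_gt0//.
apply: (@le_trans _ _ (c `^ gam)).
  apply: ler_powRr; last exact: ltW; first by have := gam_gt1 hp; lra.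
  by rewrite divr_ge0// ?mulr_ge0// ltW.
apply: (le_trans (hpatch_simeq good).2).
by rewrite mulrC expr2 mulrA ler_pM2r// mulrC; exact: (outside_far good kS kx).
Qed.

Definition outer_const : R := Num.max (16 * (Csig * (center_dist ^+ 2)^-1) * K `^ nu) K.

(** The part of the element inside the disk is treated as before; the circle,
    where nothing is known about the gradient, is a null set. *)
Lemma elem_pint_outer k : k \notin S -> ~ elem k `<=` eball x0 rho0 ->
  ((hK k `^ p)%:E * pint p (elem k)° gn <=
   ((outer_const * c `^ nu) `^ p)%:E +
   ((outer_const * c) `^ p)%:E * pint p ((elem k)° `\` far) gn)%E.
Proof.
move=> kS kB; have h0 := hK_gt0 good k; have c0 := good_gt0 good.
have e0 := center_dist_gt0.
pose B : R := Csig * (center_dist ^+ 2)^-1.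
have B0 : 0 < B by rewrite !mulr_gt0// ?invr_gt0 exprn_gt0.
have [h0W c0W e0W B0W] := And4 (ltW h0) (ltW c0) (ltW e0) (ltW B0).
have mk := measurable_elem_interior (T := T) k.
have mfar := measurable_far.
have mg := measurable_gn_elem kS.
have mI : measurable ((elem k)° `&` far : set M2) by exact: measurableI.
have mD : measurable ((elem k)° `\` far : set M2) by exact: measurableD.
have splitE : pint p (elem k)° gn =
    (pint p ((elem k)° `&` far) gn + pint p ((elem k)° `\` far) gn)%E.
  rewrite /pint -ge0_integral_setU//.
  - by rewrite setUIDK.
  - by rewrite setUIDK; exact: measurable_pow_norm.
  - by rewrite disj_set2E setDE setIACA setICr setI0.
have nearB : (pint p ((elem k)° `&` far) gn <= (B `^ p)%:E * leb2 (elem k)°)%E.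
  apply: (@le_trans _ _ ((B `^ p)%:E * leb2 ((elem k)° `&` far))%E); last first.
    apply: lee_wpmul2l; first by rewrite lee_fin powR_ge0.
    by apply: le_leb2 => //; exact: subIsetl.
  apply: pint_le_cst => //; first by apply: measurable_funS mg => //; exact: subIsetl.
  have nc : {ae leb2, forall x, ~ circle x0 rho0 x}.
    exists (circle x0 rho0); split; [exact: measurable_circle|exact: leb2_circle|].
    by move=> x /= /contrapT.
  apply: ae_leb2S (ae_leb2I G_pointwise nc) => x [Gx cx] [kx fx].
  rewrite ger0_norm ?frobnorm_ge0//.
  have xx0 := elem_neq_center kS kx.
  have xB : eball x0 rho0 x.
    by rewrite /eball /= lt_neqAle; apply/andP; split; [exact/eqP|exact: closure_eball fx].
  apply: (le_trans (Gx _ xx0)); first by split => //; exact: elem_in_domain kx.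
  have xe := outer_elem_far kS kB kx.
  have t0 : 0 < enorm (x - x0) by exact: lt_le_trans xe.
  rewrite powR_invn ?(ltW t0)// ler_pM2l// lef_pV2 ?posrE ?exprn_gt0//.
  by rewrite lerXn2r ?nnegrE// ltW.
have [hk _] : simeq K (hK k) c by have [_ hout _] := good_graded good; exact: hout.
have ocE : 16 * B * K `^ nu <= outer_const by rewrite /outer_const le_max lexx.
clearbody B.
have nu0 : 0 <= nu by have := nu_gt1 hp; lra.
rewrite splitE ge0_muleDr ?pint_ge0//; apply: leeD; last first.
  apply: lee_wpmul2r; first exact: pint_ge0.
  rewrite lee_fin; apply: ler_powRr => //; apply: (le_trans hk).
  by rewrite ler_wpM2r// /outer_const le_max lexx orbT.
apply: (@le_trans _ _ ((hK k `^ p)%:E * ((B `^ p)%:E * (16 * hK k ^+ 2)%:E))%E).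
  apply: lee_wpmul2l; first by rewrite lee_fin powR_ge0.
  apply: (le_trans nearB); apply: lee_wpmul2l; first by rewrite lee_fin powR_ge0.
  exact: (leb2_elem_le (good_tri good) closure_le h0).
rewrite -!EFinM lee_fin.
have -> : hK k `^ p * (B `^ p * (16 * hK k ^+ 2)) = 16 * (B * hK k `^ nu) `^ p.
  rewrite powRM ?powR_ge0// -powRrM nu_p// powRD; last first.
    by apply/implyP => _; exact: lt0r_neq0.
  by rewrite powR_mulrn//; ring.
apply: (@le_trans _ _ ((16 * (B * hK k `^ nu)) `^ p)).
  rewrite [leRHS]powRM ?mulr_ge0 ?powR_ge0// ler_wpM2r ?powR_ge0//.
  by apply: le1r_powR; [rewrite ler1n|exact: ltW].
apply: ler_powRr => //; first by rewrite !mulr_ge0 ?powR_ge0.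
apply: (@le_trans _ _ (16 * B * K `^ nu * c `^ nu)).
  rewrite -!mulrA !ler_pM2l// -powRM//; exact: ler_powRr.
by rewrite ler_wpM2r ?powR_ge0.
Qed.

End OneElement.

Lemma le_poweR_root (h : R) (W B : \bar R) : 0 <= h -> (0 <= W)%E ->
  ((h `^ p)%:E * W `^ p <= B)%E -> (h%:E * W <= B `^ p^-1)%E.
Proof.
move=> h0 W0 hB.
have hW0 : (0 <= h%:E * W)%E by rewrite mule_ge0// lee_fin.
have -> : (h%:E * W = ((h%:E * W) `^ p) `^ p^-1)%E.
  by rewrite -poweRrM mulfV// poweRe1.
apply: lee_poweR; rewrite ?invr_ge0// ?poweR_ge0//.
by rewrite poweRM// ?lee_fin// poweR_EFin.
Qed.

Lemma poweR_rootD (x y : \bar R) : (0 <= x)%E -> (0 <= y)%E ->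
  ((x `^ p + y `^ p) `^ p^-1 <= 2%:E * (x + y))%E.
Proof.
move=> x0' y0'; have z0 : (0 <= x + y)%E by exact: adde_ge0.
have w0 : (0 <= 2%:E * (x + y))%E by rewrite mule_ge0// lee_fin.
have -> : (2%:E * (x + y) = ((2%:E * (x + y)) `^ p) `^ p^-1)%E.
  by rewrite -poweRrM mulfV// poweRe1.
apply: lee_poweR; rewrite ?invr_ge0// ?adde_ge0 ?poweR_ge0//.
have mono (t : \bar R) : (0 <= t)%E -> (t <= x + y)%E -> (t `^ p <= (x + y) `^ p)%E.
  by move=> t0 tz; exact: lee_poweR.
rewrite poweRM// ?lee_fin// poweR_EFin.
apply: (@le_trans _ _ (2%:E * (x + y) `^ p)%E); last first.
  apply: lee_wpmul2r; first exact: poweR_ge0.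
  by rewrite lee_fin; apply: le1r_powR; [rewrite ler1n|exact: ltW].
rewrite -[2]/(1 + 1) EFinD ge0_muleDl ?lee_fin// mul1e; apply: leeD.
  by apply: mono => //; rewrite leeDl.
by apply: mono => //; rewrite leeDr.
Qed.

Section Terms.
Variables (c : R) (T : mesh R) (S : {set 'I_(ncell T)}).
Hypotheses (good : good_mesh c S) (fitT : fitted T P).
Implicit Types (k : 'I_(ncell T)).

Lemma elem_term_inner k : k \notin S -> elem k `<=` eball x0 rho0 ->
  (elem_term p sig k <= (16 * dist_const ^+ 2 * elem_bound p x0 Csig k)%:E)%E.
Proof.
move=> kS kB; have h0 := ltW (hK_gt0 good k).
have eb0 : 0 <= 16 * dist_const ^+ 2 * elem_bound p x0 Csig k.
  by rewrite /elem_bound !mulr_ge0 ?sqr_ge0 ?powR_ge0.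
have := @le_poweR_root (hK k) (W1p_seminorm p (elem k)° sig) _ h0 (W1p_seminorm_ge0 _ _ _)
  (le_trans (lee_wpmul2l _ (seminorm_le_pint good fitT kS)) (elem_pint_inner good fitT kS kB)).
rewrite lee_fin powR_ge0 => /(_ isT); rewrite poweR_EFin -powRrM mulfV// powRr1//.
Qed.

Lemma elem_term_outer k : k \notin S -> ~ elem k `<=` eball x0 rho0 ->
  (elem_term p sig k <= (2 * outer_const)%:E * ((c `^ nu)%:E +
     c%:E * LpN leb2 p%:E ((elem k)° `\` far) gn))%E.
Proof.
move=> kS kB; have h0 := ltW (hK_gt0 good k); have c0W := ltW (good_gt0 good).
have o0 : 0 <= outer_const by rewrite le_max (ltW K0) orbT.
have := @le_poweR_root (hK k) (W1p_seminorm p (elem k)° sig) _ h0 (W1p_seminorm_ge0 _ _ _)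
  (le_trans (lee_wpmul2l _ (seminorm_le_pint good fitT kS)) (elem_pint_outer good fitT kS kB)).
rewrite lee_fin powR_ge0 => /(_ isT) /le_trans; apply.
rewrite -(LpN_poweR p0) -!poweR_EFin -poweRM ?lee_fin ?mulr_ge0// ?Lnorm_ge0//.
apply: (le_trans (poweR_rootD _ _)).
- by rewrite lee_fin mulr_ge0 ?powR_ge0.
- by rewrite mule_ge0 ?Lnorm_ge0// lee_fin mulr_ge0.
rewrite !EFinM -!muleA -ge0_muleDr ?mule_ge0 ?Lnorm_ge0 ?lee_fin ?powR_ge0//.
Qed.

Lemma sum_pint_far :
  (\sum_(k < ncell T) pint p ((elem k)° `\` far) gn <= pint p (Om `\` far) gn)%E.
Proof.
have mOf : measurable (Om `\` far : set M2).
  by apply: measurableD; [exact: open_measurable2|exact: measurable_far].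
have [mgn _] := pint_frobnorm_lty p0 mOf G_far.1 G_far.2.
have mF (k : 'I_(ncell T)) : measurable ((elem k)° `\` far : set M2).
  by apply: measurableD; [exact: measurable_elem_interior|exact: measurable_far].
have sub : \big[setU/set0]_(k < ncell T) ((elem k)° `\` far) `<=` Om `\` far.
  elim/big_ind: _ => [x //|U V UB VB x [/UB|/VB]//|k _ x [kx fx]]; split => //.
  exact: (elem_in_domain fitT kx).
have mU : measurable (\big[setU/set0]_(k < ncell T) ((elem k)° `\` far) : set M2).
  by apply: bigsetU_measurable => k _.
rewrite /pint -(@ge0_integral_bigsetU _ _ _ leb2 'I_(ncell T)
  (fun k => (elem k)° `\` far) (fun x => (`|gn x| `^ p)%:E) _ mF).
- by apply: le_pint => //.
- exact: index_enum_uniq.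
- apply/trivIsetP => k l _ _ kl; have := trivIset_elem (good_tri good) (I := setT).
  move/trivIsetP => /(_ k l I I kl) h; apply/seteqP; split => // x [[kx _] [lx _]].
  by have : (set0 : set (R * R)) x by rewrite -h.
- apply: measurable_pow_norm => //.
  exact: measurable_funS mgn.
- by move=> x _; rewrite lee_fin powR_ge0.
Qed.

End Terms.

(** The far parts of the gradient contribute [c ^ p] times a finite integral in
    total, and [c ^ p = c ^ (-2) * (c ^ nu) ^ p] is at most of order
    [N * (c ^ nu) ^ p]. *)
Lemma elem_sum_le : exists2 C, 0 < C & forall c (T : mesh R) (S : {set 'I_(ncell T)}),
  good_mesh c S -> fitted T P ->
  (elem_sum p S sig <= ((ncell T)%:R * (C * (c `^ nu) `^ p))%:E)%E.
Proof.
have [CN CN0 hCN] := ncell_ge.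
have mOf : measurable (Om `\` far : set M2).
  by apply: measurableD; [exact: open_measurable2|exact: measurable_far].
have [_ jfin] := pint_frobnorm_lty p0 mOf G_far.1 G_far.2.
set j := pint p (Om `\` far) gn in jfin.
have j0 : (0 <= j)%E by exact: pint_ge0.
have jE : (fine j)%:E = j by rewrite fineK// ge0_fin_numE.
have fj0 : 0 <= fine j by exact: fine_ge0.
have dc0 : 0 < dist_const by exact: lt_le_trans dist_const_ge1.
pose A : R := 16 * dist_const ^+ 2 * (Csig * (K ^+ 2) `^ nu) + outer_const.
have o0 : 0 < outer_const by rewrite lt_max K0 orbT.
have oA : 0 < 16 * dist_const ^+ 2 * (Csig * (K ^+ 2) `^ nu).
  by rewrite !mulr_gt0// ?powR_gt0// exprn_gt0.
have A0 : 0 < A by rewrite addr_gt0.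
exists (A `^ p + outer_const `^ p * (CN * fine j)).
  by rewrite ltr_wpDr// ?powR_gt0// !mulr_ge0 ?powR_ge0// ltW.
move=> c T S good fitT; have c0 := good_gt0 good.
have [c0W A0W o0W] := And3 (ltW c0) (ltW A0) (ltW o0).
have bound (k : 'I_(ncell T)) : k \notin S ->
   ((hK k `^ p)%:E * W1p_seminorm p (elem k)° sig `^ p <=
    ((A * c `^ nu) `^ p)%:E + ((outer_const * c) `^ p)%:E * pint p ((elem k)° `\` far) gn)%E.
  move=> kS; apply: (@le_trans _ _ ((hK k `^ p)%:E * pint p (elem k)° gn)%E).
    apply: lee_wpmul2l; first by rewrite lee_fin powR_ge0.
    exact: (seminorm_le_pint good fitT kS).
  have J0 : (0 <= ((outer_const * c) `^ p)%:E * pint p ((elem k)° `\` far) gn)%E.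
    by rewrite mule_ge0 ?pint_ge0// lee_fin powR_ge0.
  have [kB|kB] := pselect (elem k `<=` eball x0 rho0).
    apply: (le_trans (elem_pint_inner good fitT kS kB)).
    apply: (@le_trans _ _ ((A * c `^ nu) `^ p)%:E); last by rewrite leeDl.
    have [eb _] := elem_bound_simeq good Csig_gt0 kS kB.
    have h0W := ltW (hK_gt0 good k).
    rewrite lee_fin; apply: ler_powRr => //.
      by rewrite /elem_bound !mulr_ge0 ?sqr_ge0 ?powR_ge0.
    have -> : A * c `^ nu = 16 * dist_const ^+ 2 * (Csig * (K ^+ 2) `^ nu * c `^ nu)
      + outer_const * c `^ nu by rewrite /A; ring.
    apply: ler_wpDr; first by rewrite mulr_ge0 ?powR_ge0.
    by rewrite ler_wpM2l// mulr_ge0 ?sqr_ge0.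
  apply: (le_trans (elem_pint_outer good fitT kS kB)); apply: leeD => //.
  rewrite lee_fin; apply: ler_powRr => //; first by rewrite mulr_ge0 ?powR_ge0.
  by rewrite ler_wpM2r ?powR_ge0// /A lerDr ltW.
pose F (k : 'I_(ncell T)) : \bar R := (((A * c `^ nu) `^ p)%:E +
  ((outer_const * c) `^ p)%:E * pint p ((elem k)° `\` far) gn)%E.
have F0 k : (0 <= F k)%E.
  by rewrite adde_ge0 ?mule_ge0 ?pint_ge0// lee_fin powR_ge0.
apply: (@le_trans _ _ (\sum_(k < ncell T) F k)%E).
  rewrite /elem_sum big_mkcond /=; apply: lee_sum => k _.
  by case: ifP => kS; [exact: bound|exact: F0].
rewrite /F big_split /= -ge0_sume_distrr; last by move=> k _; exact: pint_ge0.
rewrite sumEFin sumr_const card_ord.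
apply: (@le_trans _ _ (((ncell T)%:R * (A * c `^ nu) `^ p)%:E +
   ((outer_const * c) `^ p)%:E * j)%E).
  apply: leeD; first by rewrite mulr_natl.
  apply: lee_wpmul2l; first by rewrite lee_fin powR_ge0.
  exact: (sum_pint_far good fitT).
rewrite -jE -EFinM -EFinD lee_fin.
have cnu0 := powR_ge0 c nu.
rewrite (powRM _ A0W cnu0) (powRM _ o0W c0W).
have cp : c `^ p <= CN * (ncell T)%:R * (c `^ nu) `^ p.
  have -> : c `^ p = c `^ (- 2) * (c `^ nu) `^ p.
    rewrite -powRrM nu_p// -powRD; last by apply/implyP => _; exact: lt0r_neq0.
    by congr (_ `^ _); ring.
  by rewrite ler_wpM2r ?powR_ge0//; exact: hCN good.
have : outer_const `^ p * c `^ p * fine j <=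
  outer_const `^ p * (CN * (ncell T)%:R * (c `^ nu) `^ p) * fine j.
  by rewrite ler_wpM2r// ler_wpM2l// powR_ge0.
have -> : (ncell T)%:R * ((A `^ p + outer_const `^ p * (CN * fine j)) * (c `^ nu) `^ p) =
  (ncell T)%:R * (A `^ p * (c `^ nu) `^ p) +
  outer_const `^ p * (CN * (ncell T)%:R * (c `^ nu) `^ p) * fine j by ring.
by move=> h; rewrite lerD2l.
Qed.

End Estimates.

(** * Patch term, source term and rate *)

(** The size of the patch is chosen so that [gam * (2 / p - 1) = nu]. *)
Lemma patch_term_simeq (Csig : R) : 0 < Csig -> exists2 C, 0 < C &
  forall c (T : mesh R) (S : {set 'I_(ncell T)}), good_mesh c S ->
  simeq C (patch_term p S Csig) (c `^ nu).
Proof.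
move=> Cs0; have p0 := p_gt0 hp.
have e0 : 0 <= 2 / p - 1.
  by rewrite subr_ge0 ler_pdivlMr// mul1r ltW// p_lt2.
have Ke := powR_gt0 (2 / p - 1) K0.
exists (Csig * K `^ (2 / p - 1) + K `^ (2 / p - 1) / Csig).
  by rewrite addr_gt0 ?mulr_gt0 ?invr_gt0.
move=> c T S good; have h0 := hpatch_gt0 good; have [h1 h2] := hpatch_simeq good.
have h0W := ltW h0; have cg := powR_ge0 c gam.
have cE : c `^ nu = (c `^ gam) `^ (2 / p - 1) by rewrite -powRrM gam_nu.
have pt0 : 0 <= patch_term p S Csig by rewrite /patch_term mulr_ge0 ?powR_ge0// ltW.
split; rewrite mulrDl.
  apply: ler_wpDr; first by rewrite !mulr_ge0 ?powR_ge0 ?invr_ge0// ltW.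
  by rewrite /patch_term -mulrA ler_pM2l// cE -powRM// ler_powRr.
apply: ler_wpDl; first by rewrite !mulr_ge0 ?powR_ge0// ltW.
rewrite /patch_term mulrA divfK ?gt_eqF// cE -powRM//.
exact: ler_powRr.
Qed.

Lemma ncell_gt0 c (T : mesh R) (S : {set 'I_(ncell T)}) :
  good_mesh c S -> 0 < (ncell T)%:R :> R.
Proof.
move=> good; have [C C0 hC] := ncell_ge.
rewrite -(pmulr_rgt0 _ C0); apply: lt_le_trans (hC _ _ _ good).
by rewrite powR_gt0// (good_gt0 good).
Qed.

Lemma param_le_ncell : exists2 C, 0 < C &
  forall c (T : mesh R) (S : {set 'I_(ncell T)}), good_mesh c S ->
  c <= C * (ncell T)%:R `^ (- 2^-1).
Proof.
have [C C0 hC] := ncell_le; exists (C `^ 2^-1); first exact: powR_gt0.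
move=> c T S good; have c0 := good_gt0 good; have N0 := ncell_gt0 good.
have C0W := ltW C0; have N0W := ltW N0; have c0W := ltW c0.
have := hC _ _ _ good; rewrite powR_invn// ler_pdivlMr ?exprn_gt0// => h.
rewrite powRN ler_pdivlMr ?powR_gt0//.
have -> : c = (c ^+ 2) `^ 2^-1 by rewrite powR12_sqrt ?sqr_ge0// sqrtr_sqr ger0_norm.
by rewrite -powRM ?sqr_ge0//; apply: ler_powRr; rewrite ?mulr_ge0 ?sqr_ge0// mulrC.
Qed.

(** This uses that [c] is bounded. *)
Lemma powR_le_param r c (T : mesh R) (S : {set 'I_(ncell T)}) :
  1 <= r -> good_mesh c S -> c `^ r <= (2 * K * D) `^ (r - 1) * c.
Proof.
move=> r1 good; have c0 := good_gt0 good; have c0W := ltW c0.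
rewrite -{1}[r](subrK 1) powRD ?powRr1//; last by apply/implyP => _; exact: lt0r_neq0.
by rewrite ler_wpM2r// ler_powRr ?subr_ge0//; exact: mesh_param_le good.
Qed.

Section Source.
Variable f1 : R * R -> R.
Hypothesis Lf1 : Lp leb2 p%:E Om f1.
Local Notation F1 := (fine (LpN leb2 p%:E Om f1)).

Lemma source_fin : (F1%:E = LpN leb2 p%:E Om f1)%E.
Proof. by rewrite fineK// ge0_fin_numE ?Lnorm_ge0//; case: Lf1. Qed.

Lemma source_term_ge0 (T : mesh R) (S : {set 'I_(ncell T)}) :
  (0 <= source_term p S Om f1)%E.
Proof. by rewrite mule_ge0 ?Lnorm_ge0// lee_fin hpatch_ge0. Qed.

Lemma source_term_le c (T : mesh R) (S : {set 'I_(ncell T)}) : good_mesh c S ->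
  (source_term p S Om f1 <= (K * F1 * c `^ gam)%:E)%E.
Proof.
move=> good; have p0 := p_gt0 hp; have h0 := ltW (hpatch_gt0 good).
have F0 : 0 <= F1 by rewrite fine_ge0// Lnorm_ge0.
rewrite mulrAC EFinM source_fin; apply: lee_pmul; rewrite ?lee_fin ?Lnorm_ge0//.
  exact: (hpatch_simeq good).1.
rewrite !(LpNE p0); apply: lee_poweR; rewrite ?invr_ge0 ?pint_ge0//; first exact: ltW.
have mOm : measurable (Om : set M2) by exact: open_measurable2.
apply: le_pint => //.
  by apply: measurableI => //; apply: closed_measurable2; exact: closed_patch (good_tri good) S.
by case: Lf1.
Qed.

(** The source term is of order [c ^ gam], and [gam > nu] because [p > 1]. *)
Lemma source_term_cvg (Lam : set R) (T : R -> mesh R) (S : forall c, {set 'I_(ncell (T c))}) :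
  (forall c, Lam c -> good_mesh c (S c)) ->
  fine (source_term p (S c) Om f1) / c `^ nu @[c --> within Lam 0^'+] --> 0.
Proof.
move=> good.
have lim : K * F1 * c `^ (gam - nu) @[c --> within Lam 0^'+] --> 0.
  rewrite -[X in _ --> X](mulr0 (K * F1)); apply: cvgMr.
  have gn0 : 0 < gam - nu by rewrite subr_gt0 nu_lt_gam.
  by apply: cvg_trans (powR_cvg0 gn0); apply: cvg_app; exact: cvg_within.
apply: (squeeze_cvgr _ (cvg_cst 0) lim).
rewrite near_withinE; near=> c => Lc; have gc := good c Lc.
have c0 := good_gt0 gc; have cn := powR_gt0 nu c0.
have fs : (fine (source_term p (S c) Om f1))%:E = source_term p (S c) Om f1.
  rewrite fineK// ge0_fin_numE ?source_term_ge0//.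
  exact: le_lt_trans (source_term_le gc) (ltry _).
rewrite divr_ge0 ?fine_ge0 ?source_term_ge0 ?(ltW cn)//= ler_pdivrMr// -!mulrA.
have -> : c `^ (gam - nu) * c `^ nu = c `^ gam.
  by rewrite -powRD ?subrK//; apply/implyP => _; exact: lt0r_neq0.
by rewrite mulrA -lee_fin fs; exact: source_term_le.
Unshelve. all: by end_near. Qed.

End Source.

Section Rates.
Variables (J : nat) (P : 'I_J -> set (R * R)) (sig : R * R -> R * R).
Variables (G : R * R -> (R * R) * (R * R)) (Csig : R).
Hypotheses (partP : partition_of P Om) (hG : broken_grad P x0 sig G) (Csig_gt0 : 0 < Csig).
Hypothesis G_pointwise : {ae leb2, forall x, (Om `&` eball x0 rho0) x -> x <> x0 ->
     frobnorm (G x) <= Csig * enorm (x - x0) `^ (- 2)}.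
Hypothesis G_far : LpV leb2 p%:E (Om `\` closure (eball x0 rho0)) (fst \o G) /\
         LpV leb2 p%:E (Om `\` closure (eball x0 rho0)) (snd \o G).
Let p0 : 0 < p := p_gt0 hp.
Let p0W := ltW p0.
Let pV0 : 0 <= p^-1. Proof. by rewrite invr_ge0. Qed.

Lemma elem_sum_ge0 (T : mesh R) (S : {set 'I_(ncell T)}) : (0 <= elem_sum p S sig)%E.
Proof.
by apply: sume_ge0 => k _; rewrite mule_ge0 ?poweR_ge0// lee_fin powR_ge0.
Qed.

Lemma elem_mean_le : exists2 C, 0 < C & forall c (T : mesh R) (S : {set 'I_(ncell T)}),
  good_mesh c S -> fitted T P ->
  ((((ncell T)%:R^-1)%:E * elem_sum p S sig) `^ p^-1 <= (C * c `^ nu)%:E)%E.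
Proof.
have [C C0 hC] := elem_sum_le partP hG Csig_gt0 G_pointwise G_far.
exists (C `^ p^-1); first exact: powR_gt0.
move=> c T S good fitT; have N0 := ncell_gt0 good; have C0W := ltW C0.
have -> : C `^ p^-1 * c `^ nu = (C * (c `^ nu) `^ p) `^ p^-1.
  by rewrite powRM ?powR_ge0// -[in RHS]powRrM mulfV ?gt_eqF// powRr1 ?powR_ge0.
rewrite -poweR_EFin; apply: lee_poweR => //.
  by rewrite mule_ge0 ?elem_sum_ge0// lee_fin invr_ge0 ltW.
rewrite lee_pdivrMl//; exact: hC.
Qed.

(** All contributions are of order [c]: the sum of [N ~ c ^ (-2)] terms of order
    [c ^ nu] in the l^p norm is of order [c ^ (nu - 2 / p) = c]. *)
Lemma flux_rate (f1 : R * R -> R) (CSP Cf : R) : 0 < CSP -> 0 < Cf ->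
  Lp leb2 p%:E Om f1 -> exists2 C, 0 < C &
  forall c (T : mesh R) (S : {set 'I_(ncell T)}) (sigh : R * R -> R * R),
  good_mesh c S -> fitted T P ->
  flux_estimate p S sig Om f1 Csig CSP Cf sigh ->
  (LpN leb2 p%:E Om (fun x => enorm (sig x - sigh x)%R) <=
    (C * (ncell T)%:R `^ (- 2^-1))%:E)%E.
Proof.
move=> CSP0 Cf0 Lf1.
have [Cp Cp0 hCp] := patch_term_simeq Csig_gt0.
have [CE CE0 hCE] := elem_sum_le partP hG Csig_gt0 G_pointwise G_far.
have [CN CN0 hCN] := ncell_le.
have [Cc Cc0 hCc] := param_le_ncell.
pose X : R := 2 * K * D.
pose F : R := fine (LpN leb2 p%:E Om f1).
have F0 : 0 <= F by rewrite fine_ge0// Lnorm_ge0.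
pose E : R := Cp * X `^ (nu - 1) + K * F * X `^ (gam - 1) + (CN * CE) `^ p^-1.
have E0 : 0 < E.
  rewrite ltr_wpDl ?powR_gt0 ?mulr_gt0// addr_ge0// !mulr_ge0 ?powR_ge0//; exact: ltW.
have S0 : 0 < 1 + CSP by rewrite addr_gt0.
exists (Cf * (1 + CSP) * E * Cc); first by rewrite !mulr_gt0.
move=> c T S sigh good fitT hflux; have c0 := good_gt0 good; have c0W := ltW c0.
have FS0 : 0 < Cf * (1 + CSP) by rewrite mulr_gt0.
apply: (le_trans hflux).
apply: (@le_trans _ _ ((Cf * (1 + CSP))%:E * (E * c)%:E)%E); last first.
  rewrite -EFinM lee_fin -!mulrA !ler_pM2l//.
  exact: hCc good.
apply: lee_wpmul2l; first by rewrite lee_fin ltW.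
rewrite /E !mulrDl !EFinD; apply: leeD; first apply: leeD.
- rewrite lee_fin; apply: (le_trans (hCp _ _ _ good).1).
  rewrite -mulrA ler_pM2l//; apply: (powR_le_param _ good).
  by apply: ltW; exact: nu_gt1.
- apply: (le_trans (source_term_le Lf1 good)).
  rewrite lee_fin -/F -[leRHS]mulrA ler_wpM2l ?mulr_ge0//.
  by apply: (powR_le_param _ good); apply: ltW; exact: gam_gt1.
have cE : c = (c `^ (- 2) * (c `^ nu) `^ p) `^ p^-1.
  rewrite -powRrM nu_p// -powRD; last by apply/implyP => _; exact: lt0r_neq0.
  rewrite (_ : - 2 + (p + 2) = p); last by ring.
  by rewrite -powRrM mulfV ?gt_eqF// powRr1.
rewrite {1}cE -powRM ?mulr_ge0 ?powR_ge0 ?(ltW CN0) ?(ltW CE0)//.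
rewrite -poweR_EFin; apply: lee_poweR => //; first exact: elem_sum_ge0.
apply: (le_trans (hCE _ _ _ good fitT)); rewrite lee_fin.
rewrite (_ : CN * CE * (c `^ (- 2) * (c `^ nu) `^ p) =
  CN * c `^ (- 2) * (CE * (c `^ nu) `^ p)); last by ring.
by rewrite ler_wpM2r ?mulr_ge0 ?powR_ge0 ?(ltW CE0)//; exact: hCN good.
Qed.

End Rates.

End GradedMesh.

(** * Convergence on graded meshes *)

Theorem proposition5p10 (R : realType) (p : R) (hp : 1 < p < 2)
  (* continuous problem *)
  (Om : set (R * R)) (bOm : bounded_set Om) (LOm : lipschitz_domain Om)
  (scOm : simply_connected Om) (x0 : R * R) (x0Om : Om x0)
  (alpha beta : R) (A : R * R -> 'M[R]_2)
  (ellA : elliptic_field alpha beta Om A)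
  (s : {measure set (measurableTypeR R * measurableTypeR R) -> \bar R})
  (hs : surface_measure Om s)
  (f1 : R * R -> R) (Lf1 : Lp leb2 p%:E Om f1)
  (g : R * R -> R) (Wg : Wfrac (1 - p^-1) p Om s g)
  (u : R * R -> R) (Du : R * R -> R * R)
  (solu : bvp_solution p Om s A x0 f1 g u Du)
  (uniqu : forall v Dv, bvp_solution p Om s A x0 f1 g v Dv ->
     {ae leb2, forall x, Om x -> v x = u x})
  (* partition *)
  (J : nat) (P : 'I_J -> set (R * R))
  (partP : partition_of P Om) (subP : subordinate P A)
  (* one mesh, with its patch, for each parameter c in Lam *)
  (Lam : set R) (Lam_gt0 : forall c, Lam c -> 0 < c)
  (T : R -> mesh R) (S : forall c, {set 'I_(ncell (T c))})
  (triT : forall c, Lam c -> triangulation (T c) Om)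
  (regT : exists kap, forall c, Lam c -> shape_regular (T c) kap)
  (fitT : forall c, Lam c -> fitted (T c) P)
  (patS : exists m kap, forall c, Lam c -> is_patch (S c) x0 m kap)
  (rho0 : R) (rho0_gt0 : 0 < rho0)
  (gradT : exists kap, forall c, Lam c -> graded (S c) p rho0 c x0 kap)
  (* discrete solutions *)
  (sigh : R -> R * R -> R * R) (uh : R -> R * R -> R)
  (solh : forall c, Lam c ->
     mixed_solution (T c) Om A p s x0 f1 g (sigh c) (uh c))
  (* (i) *)
  (Csig : R) (Csig_gt0 : 0 < Csig)
  (h1 : {ae leb2, forall x, (Om `&` eball x0 rho0) x -> x <> x0 ->
     enorm (flux A x0 Du x) <= Csig * enorm (x - x0) `^ (- 1)})
  (* (ii) *)
  (h2 : forall c, Lam c -> forall k, k \notin S c ->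
     W1pV p (elem k)° (flux A x0 Du))
  (h2' : forall c, Lam c -> patch_set (S c) `<=` eball x0 rho0)
  (* (iii) *)
  (G : R * R -> (R * R) * (R * R)) (hG : broken_grad P x0 (flux A x0 Du) G)
  (h3 : {ae leb2, forall x, (Om `&` eball x0 rho0) x -> x <> x0 ->
     frobnorm (G x) <= Csig * enorm (x - x0) `^ (- 2)})
  (h3' : LpV leb2 p%:E (Om `\` closure (eball x0 rho0)) (fst \o G) /\
         LpV leb2 p%:E (Om `\` closure (eball x0 rho0)) (snd \o G))
  (* (iv) *)
  (CSP : R) (CSP_gt0 : 0 < CSP)
  (h4 : forall c, Lam c -> forall rho r, LpV leb2 p%:E Om rho ->
     is_Rh (T c) Om A rho r ->
     (LpN leb2 p%:E Om (enorm \o r) <= CSP%:E * LpN leb2 p%:E Om (enorm \o rho))%E)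
  (* the flux estimate *)
  (hflux : exists Cf, 0 < Cf /\ forall c, Lam c ->
     flux_estimate p (S c) (flux A x0 Du) Om f1 Csig CSP Cf (sigh c)) :
  (exists C, 0 < C /\ forall c, Lam c ->
     [/\ (* patch term *)
         simeq C (patch_term p (S c) Csig) (c `^ (1 + 2 / p)),
         (* elementwise terms where (iii) gives a pointwise bound *)
         (forall k, k \notin S c -> elem k `<=` eball x0 rho0 ->
            (elem_term p (flux A x0 Du) k <= (C * elem_bound p x0 Csig k)%:E)%E /\
            simeq C (elem_bound p x0 Csig k) (c `^ (1 + 2 / p))),
         (* elementwise terms where (iii) gives only an L^p bound: one by one,
            then all elementwise terms in the mean of order p *)
         (forall k, k \notin S c -> ~ elem k `<=` eball x0 rho0 ->
            (elem_term p (flux A x0 Du) k <= C%:E * ((c `^ (1 + 2 / p))%:E +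
               c%:E * LpN leb2 p%:E ((elem k)° `\` closure (eball x0 rho0))
                        (frobnorm \o G)))%E) /\
         (((ncell (T c))%:R^-1%:E * elem_sum p (S c) (flux A x0 Du)) `^ p^-1 <=
            (C * c `^ (1 + 2 / p))%:E)%E,
         (* number of elements *)
         simeq C (ncell (T c))%:R (c `^ (- 2)) &
         (* convergence rate *)
         (LpN leb2 p%:E Om (fun x => enorm (flux A x0 Du x - sigh c x)%R) <=
            (C * (ncell (T c))%:R `^ (- 2^-1))%:E)%E]) /\
  (* source term *)
  (fine (source_term p (S c) Om f1) / c `^ (1 + 2 / p)
     @[c --> within Lam 0^'+] --> 0).
Proof.
case: patS => m [kp hkp]; case: regT => kr hkr; case: gradT => kg hkg.
case: hflux => Cf [Cf0 hCf].
have oOm : open Om by case: LOm => [[]].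
have [D D1 OmD] := bounded_eball x0 bOm.
pose K := Num.max 1 (Num.max kr (Num.max kp kg)).
have K1 : 1 <= K by rewrite le_max lexx.
have kr_le : kr <= K by rewrite !le_max lexx orbT.
have kp_le : kp <= K by rewrite !le_max lexx !orbT.
have kg_le : kg <= K by rewrite !le_max lexx !orbT.
have good c : Lam c -> good_mesh p Om x0 K rho0 m c (S c).
  move=> Lc; apply: (good_mesh_of OmD kr_le kp_le kg_le) => //; [exact: Lam_gt0|
    exact: triT|exact: hkr|exact: hkp|exact: hkg].
have [C1 C10 hC1] := @patch_term_simeq R p Om x0 K rho0 m hp K1 Csig Csig_gt0.
have [C2 C20 hC2] := @ncell_le R p Om x0 K D rho0 m hp oOm x0Om K1 D1 OmD.
have [C3 C30 hC3] := @ncell_ge R p Om x0 K D rho0 m hp oOm x0Om K1 D1 OmD.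
have [C4 C40 hC4] := @elem_mean_le R p Om x0 K D rho0 m hp oOm x0Om K1 D1 rho0_gt0 OmD
  J P _ G Csig partP hG Csig_gt0 h3 h3'.
have [C5 C50 hC5] := @flux_rate R p Om x0 K D rho0 m hp oOm x0Om K1 D1 rho0_gt0 OmD
  J P _ G Csig partP hG Csig_gt0 h3 h3' f1 CSP Cf CSP_gt0 Cf0 Lf1.
split; last exact: (source_term_cvg hp oOm K1 Lf1 good).
have K0 : 0 < K by exact: lt_le_trans K1.
pose C6 := 16 * dist_const p K ^+ 2.
pose C7 := Csig * (K ^+ 2) `^ rate_exp p.
pose C8 := K `^ rate_exp p / Csig.
pose C9 := 2 * outer_const p K rho0 Csig.
pose C := Num.max C1 (Num.max C2 (Num.max C3 (Num.max C4 (Num.max C5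
  (Num.max C6 (Num.max C7 (Num.max C8 C9))))))).
have [le1 le2 le3 le4] : [/\ C1 <= C, C2 <= C, C3 <= C & C4 <= C].
  by rewrite /C !le_max !lexx ?orbT.
have [le5 le6 le7 le8] : [/\ C5 <= C, C6 <= C, C7 <= C & C8 <= C].
  by rewrite /C !le_max !lexx ?orbT.
have le9 : C9 <= C by rewrite /C !le_max lexx ?orbT.
exists C; split; first exact: lt_le_trans le1.
move=> c Lc.
have gc := good c Lc; have fc := fitT c Lc; have c0 := Lam_gt0 c Lc.
have cn0 := powR_ge0 c (1 + 2 / p).
split.
- apply: simeqS le1 _ cn0 (hC1 _ _ _ gc).
  by rewrite /patch_term mulr_ge0 ?powR_ge0// ltW.
- move=> k kS kB; have hk0 := hK_gt0 K1 gc k.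
  have eb0 : 0 <= elem_bound p x0 Csig k.
    by rewrite /elem_bound !mulr_ge0 ?powR_ge0// ltW.
  split.
    apply: (le_trans (elem_term_inner hp oOm x0Om K1 OmD partP hG Csig_gt0 h3 gc fc kS kB)).
    by rewrite lee_fin ler_wpM2r.
  have [e1 e2] := elem_bound_simeq hp oOm x0Om K1 gc Csig_gt0 kS kB.
  split; [apply: (le_trans e1)|apply: (le_trans e2)]; by rewrite ler_wpM2r.
- split; last first.
    by apply: (le_trans (hC4 _ _ _ gc fc)); rewrite lee_fin ler_wpM2r.
  move=> k kS kB.
  apply: (le_trans (elem_term_outer hp oOm x0Om K1 rho0_gt0 OmD partP hG Csig_gt0 h3 gc fc kS kB)).
  apply: lee_wpmul2r; last by rewrite lee_fin.
  by rewrite adde_ge0 ?lee_fin// mule_ge0 ?Lnorm_ge0// lee_fin ltW.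
- have N0 : 0 <= (ncell (T c))%:R :> R by [].
  have c20 := powR_ge0 c (- 2).
  split.
    by apply: (le_trans (hC2 _ _ _ gc)); rewrite ler_wpM2r.
  by apply: (le_trans (hC3 _ _ _ gc)); rewrite ler_wpM2r.
- apply: (le_trans (hC5 _ _ _ (sigh c) gc fc (hCf c Lc))).
  by rewrite lee_fin ler_wpM2r ?powR_ge0.
Qed.
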